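(* Let $\boldsymbol\mu=\{\mu_t\}_{t>0}$ be a Palm-uniformizable measurable factorizing family over $[0,1]\times\{\ast\}$ with $\mu_t(\{\varnothing\})>0$ for all $t>0$. Fix $\beta>0$ and $L(t)=|\ln t|$ for $t\in(0,1)$. Let $\mu_t^{\mathrm{loc},\alpha}$ be the anchor-adapted localized tilt of $\mu_t$, $\mu_t^{\mathrm{unif},\alpha}$ its Palm-uniformization, and $\nu_t:=e^{-\beta t}\delta_\varnothing+(1-e^{-\beta t})\,\mu_t^{\mathrm{unif},\alpha}(\cdot\mid Z\neq\varnothing)$. Then (i) $\boldsymbol\nu=\{\nu_t\}_{t>0}$ is a measurable factorizing family and $\nu_t\sim\mu_t$ for every $t$; (ii) the random-set system $\mathbb E^{\boldsymbol\nu}$ is isomorphic to $\mathbb E^{\boldsymbol\mu}$; (iii) the vacuum unit $v_t=\nu_t(\{\varnothing\})^{-1/2}\mathbf 1_{\{\varnothing\}}$ satisfies $m(t):=\langle\mathbf 1,v_t\rangle=e^{-\beta t/2}$, hence $1-m(t)\ge\frac{\beta}{4}t$ for $0<t\le2/\beta$.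
   Context: $\mathscr C_t^{\{\ast\}}$ is the space of closed subsets of $[0,t]$ with Borel $\sigma$-field $\Sigma_t$ of the Fell topology; $\oplus_{s,t}(Z_1,Z_2)=Z_1\cup(s+Z_2)$; $\sigma_t(Z)=\{r/t:r\in Z\}$. A measurable factorizing family over $[0,1]\times\{\ast\}$ is a family of probability measures $\mu_t$ on $\mathscr C_t^{\{\ast\}}$ with: (i) $\mu_{s+t}\sim(\mu_s\otimes\mu_t)\circ\oplus_{s,t}^{-1}$ ($\sim$: mutual absolute continuity); (ii) $\mu_t(\{Z:r\in Z\})=0$ for all $r\in[0,t]$; (iii) no $\mu_t$ supported on finitely many atoms; (iv a) a countable ring $\mathcal R\subset\Sigma_1$ generating $\Sigma_1$ with $t\mapsto(\sigma_t)_*\mu_t(A)$ Borel for $A\in\mathcal R$; (iv b) a Borel $\Delta:(0,\infty)^2\times\mathscr C_1^{\{\ast\}}\to(0,\infty)$ with $\Delta(s,t,\sigma_{s+t}(Z))=\Delta_{s,t}(Z)$ a.e., $\Delta_{s,t}=d((\mu_s\otimes\mu_t)\circ\oplus_{s,t}^{-1})/d\mu_{s+t}$. Its random-set system $\mathbb E^{\boldsymbol\mu}$ is the Arveson product system with fibers $L^2(\mu_t)$ and multiplication $U_{s,t}(f\otimes g)(Z)=\Delta_{s,t}(Z)^{1/2}f(Z\cap[0,s])g((Z\cap[s,s+t])-s)$. Anchor: $\alpha_t(Z)=\inf Z$ ($0$ if $Z=\varnothing$); spread: $\mathrm{diam}_t(Z)=\sup Z-\inf Z$ ($0$ if empty).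 $\boldsymbol\mu$ is Palm-uniformizable if $(\alpha_t)_*(\mu_t(\cdot\cap\{Z\neq\varnothing\}))\sim\mathrm{Leb}|_{(0,t]}$ for every $t$. Anchor-adapted localized tilt: for $t\in(0,1)$, $d\mu_t^{\mathrm{loc},\alpha}(Z)\propto\big(\mathbf 1_{\{\varnothing\}}+\mathbf 1_{\{Z\neq\varnothing,\alpha_t>0\}}\exp(-L(\alpha_t(Z))\mathrm{diam}_t(Z)/\alpha_t(Z)^2)+\mathbf 1_{\{Z\neq\varnothing,\alpha_t=0\}}\big)d\mu_t(Z)$ (normalized to a probability), and $\mu_t^{\mathrm{loc},\alpha}:=\mu_t$ for $t\ge1$. Palm-uniformization of $\rho=\mu_t^{\mathrm{loc},\alpha}$: with $\kappa=(\alpha_t)_*(\rho(\cdot\cap\{Z\neq\varnothing\}))$ (equivalent to $\mathrm{Leb}|_{(0,t]}$) and $h$ a Borel version of $d\mathrm{Leb}|_{(0,t]}/d\kappa$, $d\rho^{\mathrm{unif}}\propto(\mathbf 1_{\{\varnothing\}}+\mathbf 1_{\{Z\neq\varnothing\}}h(\alpha_t(Z)))d\rho$, normalized. Isomorphism of product systems means a measurable family of unitaries between fibers intertwining the multiplications. *)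

(* Defs.v *)
From HB Require Import structures.
From mathcomp Require Import all_boot all_order all_algebra.
From mathcomp Require Import all_classical all_reals all_analysis.
From mathcomp Require Import measurable_realfun.
From mathcomp Require Import complex.

Unset Strict Implicit.
Unset Printing Implicit Defensive.
Import Order.TTheory GRing.Theory Num.Theory.
Import numFieldNormedType.Exports.
Local Open Scope classical_set_scope.
Local Open Scope ring_scope.
Local Open Scope complex_scope.

(* The spaces C_t of closed subsets of [0,t] are realised as the       *)
(* (measurable) subsets [Csub t] of the ambient space [Cl R] of all    *)
(* closed subsets of R; a measure on C_t is a measure on [Cl R]        *)
(* concentrated on [Csub t].                                            *)
Record cset (R : realType) := CSet { cval : set R ; cval_closed : closed cval }.
Arguments CSet {R}.
Arguments cval {R}.

HB.instance Definition _ (R : realType) := gen_eqMixin (cset R).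
HB.instance Definition _ (R : realType) := gen_choiceMixin (cset R).
HB.instance Definition _ (R : realType) :=
  isPointed.Build (cset R) (@CSet R set0 closed0).

(* closed hull of a set (used to build the closed sets below; all of them
   are already closed, so the closure is the identity on them) *)
Definition mkc {R : realType} (X : set R) : cset R :=
  @CSet R (closure X) (@closed_closure _ X).

(* hitting sets {Z | Z meets U}, U open: they generate the Borel
   sigma-field of the Fell topology (Effros sigma-algebra) *)
Definition hit_sets (R : realType) : set (set (cset R)) :=
  [set [set Z : cset R | cval Z `&` U !=set0] | U in [set U : set R | open U]].

Definition Cl (R : realType) := g_sigma_algebraType (hit_sets R).

Section ops.
Variable R : realType.

Definition cempty : Cl R := @CSet R set0 closed0.

Definition Csub (t : R) : set (Cl R) := [set Z | cval Z `<=` `[0, t]].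

Definition oplus (s : R) (Z12 : Cl R * Cl R) : Cl R :=
  mkc (cval Z12.1 `|` [set s + x | x in cval Z12.2]).

Definition restr (s : R) (Z : Cl R) : Cl R := mkc (cval Z `&` `[0, s]).

Definition rshift (s t : R) (Z : Cl R) : Cl R :=
  mkc [set x - s | x in cval Z `&` `[s, s + t]].

Definition scale (t : R) (Z : Cl R) : Cl R := mkc [set r / t | r in cval Z].

Definition anchor (Z : Cl R) : R :=
  if `[< cval Z = set0 >] then 0 else inf (cval Z).

Definition diam (Z : Cl R) : R :=
  if `[< cval Z = set0 >] then 0 else sup (cval Z) - inf (cval Z).

Definition nonempty_sets : set (Cl R) := [set Z | Z <> cempty].
End ops.
Arguments Csub {R}.
Arguments oplus {R}.
Arguments restr {R}.
Arguments rshift {R}.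
Arguments scale {R}.
Arguments anchor {R}.
Arguments diam {R}.

Section meas.
Context d (T : measurableType d) (R : realType).
Local Open Scope ereal_scope.

Definition mequiv (m1 m2 : set T -> \bar R) := m1 `<< m2 /\ m2 `<< m1.

Definition is_density (m1 m2 : set T -> \bar R) (D : T -> R) :=
  measurable_fun setT D /\
  forall A, measurable A -> m1 A = \int[m2]_(x in A) (D x)%:E.
End meas.
Arguments mequiv {d T R}.
Arguments is_density {d T R}.

Section family.
Variable R : realType.
Local Open Scope ereal_scope.
Implicit Types (mu : R -> set (Cl R) -> \bar R).

Definition Delta_of mu (s t : R) (D : Cl R -> R) :=
  is_density (pushforward (mu s \x mu t) (oplus s)) (mu (s + t)%R) D.

Definition MFF (mu : R -> probability (Cl R) R) : Prop :=
  [/\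
      (forall t, (0 < t)%R -> mu t (~` Csub t) = 0),
      (forall s t, (0 < s)%R -> (0 < t)%R ->
         mequiv (pushforward (mu s \x mu t) (oplus s)) (mu (s + t)%R)),
      (forall t r, (0 < t)%R -> (0 <= r <= t)%R -> mu t [set Z | cval Z r] = 0),
      (forall t, (0 < t)%R ->
         ~ exists S : seq (Cl R), mu t [set Z | Z \notin S] = 0)
    &
      ((exists Rg : set (set (Cl R)),
         [/\ countable Rg, setring Rg,
             Rg `<=` [set A | measurable A /\ A `<=` Csub 1%R],
             <<s Csub 1%R, Rg >> = [set A `&` Csub 1%R | A in measurable]
           & forall A, Rg A ->
               measurable_fun (`]0%R, +oo[ : set R) (fun t : R => mu t (scale t @^-1` A))]) /\
      (exists Delta : R * R * Cl R -> R,
         [/\ measurable_fun setT Delta,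
             (forall x, (0 < Delta x)%R)
           & forall s t, (0 < s)%R -> (0 < t)%R ->
               Delta_of mu s t (fun Z => Delta (s, t, scale (s + t)%R Z))]))].

Definition palm_uniformizable (mu : R -> probability (Cl R) R) : Prop :=
  forall t, (0 < t)%R ->
    mequiv (pushforward (fun A => mu t (A `&` nonempty_sets R)) (@anchor R))
           (fun B : set R => lebesgue_measure (B `&` `]0%R, t]%classic)).
End family.
Arguments Delta_of {R}.
Arguments MFF {R}.
Arguments palm_uniformizable {R}.

Section L2.
Variable R : realType.
Local Open Scope ereal_scope.
Implicit Types (m : set (Cl R) -> \bar R) (f g : Cl R -> R[i]).

Definition cnorm2 (z : R[i]) : R := (complex.Re z ^+ 2 + complex.Im z ^+ 2)%R.

Definition L2 m f :=
  [/\ measurable_fun setT (fun x => complex.Re (f x)),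
      measurable_fun setT (fun x => complex.Im (f x))
    & \int[m]_x (cnorm2 (f x))%:E < +oo].

Definition inner m f g : R[i] :=
  (fine (\int[m]_x (complex.Re ((f x)^* * g x)%R)%:E)) +i*
  (fine (\int[m]_x (complex.Im ((f x)^* * g x)%R)%:E)).

Definition aeeq m f g := {ae m, forall x, f x = g x}.

(* W is a unitary L^2(m1) -> L^2(m2) (acting on representatives) *)
Definition is_unitary m1 m2 (W : (Cl R -> R[i]) -> (Cl R -> R[i])) :=
  [/\ (forall f, L2 m1 f -> L2 m2 (W f)),
      (forall f g, L2 m1 f -> L2 m1 g -> aeeq m1 f g -> aeeq m2 (W f) (W g)),
      (forall (a : R[i]) f g, L2 m1 f -> L2 m1 g ->
         aeeq m2 (W (fun x => a * f x + g x)%R) (fun x => a * W f x + W g x)%R),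
      (forall f g, L2 m1 f -> L2 m1 g -> inner m2 (W f) (W g) = inner m1 f g)
    & (forall h, L2 m2 h -> exists f, L2 m1 f /\ aeeq m2 (W f) h)].

(* multiplication of the random-set system, given a version D of Delta_{s,t}:
   U_{s,t}(f (x) g)(Z) = D(Z)^{1/2} f(Z \cap [0,s]) g((Z \cap [s,s+t]) - s) *)
Definition Umul (s t : R) (D : Cl R -> R) f g : Cl R -> R[i] :=
  fun Z => ((Num.sqrt (D Z))%:C * f (restr s Z) * g (rshift s t Z))%R.

(* measurability of a family of unitaries, read through the identification
   sigma_t : C_t -> C_1 (weak measurability in t of matrix coefficients
   against bounded measurable test functions on C_1) *)
Definition meas_family (mu nu : R -> set (Cl R) -> \bar R)
  (W : R -> (Cl R -> R[i]) -> (Cl R -> R[i])) :=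
  forall F G : Cl R -> R[i],
    measurable_fun setT (fun x => complex.Re (F x)) -> measurable_fun setT (fun x => complex.Im (F x)) ->
    measurable_fun setT (fun x => complex.Re (G x)) -> measurable_fun setT (fun x => complex.Im (G x)) ->
    (exists M : R, forall x, (cnorm2 (F x) <= M)%R /\ (cnorm2 (G x) <= M)%R) ->
    measurable_fun (`]0%R, +oo[ : set R)
      (fun t : R => complex.Re (inner (nu t) (W t (F \o scale t)) (G \o scale t))) /\
    measurable_fun (`]0%R, +oo[ : set R)
      (fun t : R => complex.Im (inner (nu t) (W t (F \o scale t)) (G \o scale t))).

Definition rs_isomorphic (mu nu : R -> set (Cl R) -> \bar R) :=
  exists W : R -> (Cl R -> R[i]) -> (Cl R -> R[i]),
    [/\ forall t, (0 < t)%R -> is_unitary (mu t) (nu t) (W t),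
        meas_family mu nu W
      & forall s t, (0 < s)%R -> (0 < t)%R ->
          forall Dm Dn, Delta_of mu s t Dm -> Delta_of nu s t Dn ->
          forall f g, L2 (mu s) f -> L2 (mu t) g ->
            aeeq (nu (s + t)%R) (W (s + t)%R (Umul s t Dm f g))
                              (Umul s t Dn (W s f) (W t g))].

Definition vacuum (m : set (Cl R) -> \bar R) : Cl R -> R[i] :=
  fun Z => ((Num.sqrt (fine (m [set cempty R])))^-1 *
            \1_[set cempty R] Z)%R%:C.
End L2.
Arguments L2 {R}.
Arguments inner {R}.
Arguments aeeq {R}.
Arguments is_unitary {R}.
Arguments Umul {R}.

Arguments meas_family {R}.
Arguments rs_isomorphic {R}.
Arguments vacuum {R}.

Section construction.
Variable R : realType.
Local Open Scope ereal_scope.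

Definition Lfun (t : R) : R := `| ln t |%R.

Definition wloc (t : R) (Z : Cl R) : R :=
  if (t < 1)%R then
    if Z == cempty R then 1%R
    else if (0 < anchor Z)%R
         then expR (- (Lfun (anchor Z) * diam Z / anchor Z ^+ 2))%R
         else 1%R
  else 1%R.

Definition tilt (m : set (Cl R) -> \bar R) (w : Cl R -> R) : set (Cl R) -> \bar R :=
  fun A => ((fine (\int[m]_x (w x)%:E))^-1)%:E * \int[m]_(x in A) (w x)%:E.

Definition mu_loc (mu : R -> set (Cl R) -> \bar R) (t : R) := tilt (mu t) (wloc t).

Definition kappa (rho : set (Cl R) -> \bar R) : set R -> \bar R :=
  pushforward (fun A => rho (A `&` nonempty_sets R)) (@anchor R).

(* Palm-uniformization of rho with a given version h of dLeb|_(0,t]/dkappa *)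
Definition unif (rho : set (Cl R) -> \bar R) (h : R -> R) :=
  tilt rho (fun Z => if Z == cempty R then 1%R else h (anchor Z)).

Definition cond_ne (m : set (Cl R) -> \bar R) : set (Cl R) -> \bar R :=
  fun A => m (A `&` nonempty_sets R) * ((fine (m (nonempty_sets R)))^-1)%:E.

Definition nu_def (mu : R -> set (Cl R) -> \bar R) (beta : R) (h : R -> R -> R)
  (t : R) : set (Cl R) -> \bar R :=
  fun A => (expR (- (beta * t))%R)%:E * (\1_A (cempty R))%:E +
           (1 - expR (- (beta * t)))%R%:E * cond_ne (unif (mu_loc mu t) (h t)) A.
End construction.
Arguments wloc {R}.
Arguments tilt {R}.
Arguments mu_loc {R}.
Arguments kappa {R}.
Arguments unif {R}.
Arguments cond_ne {R}.
Arguments nu_def {R}.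

(* Main.v *)
(** The measure [nu_t] has an explicit positive density [g_t] with respect to
    [mu_t]: on nonempty sets it is a constant times
    [w_t(Z) / k_t(anchor Z)], where [w_t] is the tilt weight and [k_t] is the
    Lebesgue density of the anchor law of [w_t mu_t] (normalizing constants of
    the tilt cancel).  The density [h_t] of the statement is an arbitrary version
    for each [t], so measurability in [t] must come from another version: by
    Lebesgue differentiation [k_t(x)] is a limit of averages of the anchor law
    over shrinking balls, and these are jointly measurable in [(t, x)] because
    the rescaled measures form a kernel.  Given a jointly measurable positive
    density, everything transfers: outside a null set, cutting [Z1 u (s + Z2)] at
    [s] returns [Z1] and [Z2], so [Delta] is multiplied by
    [g_s(Z1) g_t(Z2) / g_(s+t)], and multiplication by [sqrt g_t] is the
    isomorphism of product systems. *)
Require Import Defs.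
From HB Require Import structures.
From mathcomp Require Import all_boot all_order all_algebra.
From mathcomp Require Import all_classical all_reals all_analysis.
From mathcomp Require Import measurable_realfun.
From mathcomp Require Import complex.
From mathcomp Require Import ring lra.
Import Order.TTheory GRing.Theory Num.Theory.
Import numFieldNormedType.Exports.
Local Open Scope classical_set_scope.
Local Open Scope ring_scope.
Local Open Scope complex_scope.

Set Implicit Arguments.
Unset Strict Implicit.

(** Palm-uniformization turns the anchor law of the nonempty part into a multiple of Lebesgue
    measure on (0, t], whose mass is t. Conditioning on nonempty sets therefore leaves exactly a
    factor 1/t: g_t is (1 - exp(-beta t)) w_t / (t k_t) on nonempty sets, and exp(-beta t) /
    mu_t({empty}) at the empty set.

    Palm-uniformizability enters as absolute continuity of the anchor law with respect to Lebesgue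
    measure; without it k_t would miss a part of that law.

    The density must be positive at every point, not just almost everywhere, since the new [Delta]
    is required to be positive everywhere. So k_t is taken as a limsup, which always exists, and is
    reset to 1 wherever it is not both positive and finite.

    The new [Delta] must also be Borel jointly in both times and the set. This is why cutting,
    shifting and scaling are shown measurable with times that vary with the point, which leads to
    hitting events of intervals with moving endpoints. *)

Lemma measurable_set_lt d (T : measurableType d) (R : realType) (f g : T -> R) :
  measurable_fun setT f -> measurable_fun setT g ->
  measurable [set x | f x < g x].
Proof.
move=> mf mg; rewrite -[X in measurable X]setTI.
exact: (measurable_fun_ltr mf mg measurableT (Y := [set true])).
Qed.

Lemma measurable_set_le d (T : measurableType d) (R : realType) (f g : T -> R) :
  measurable_fun setT f -> measurable_fun setT g ->
  measurable [set x | f x <= g x].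
Proof.
move=> mf mg; rewrite -[X in measurable X]setTI.
exact: (measurable_fun_ler mf mg measurableT (Y := [set true])).
Qed.

Lemma bigcapT_measurable_rat d (T : measurableType d) (F : rat -> set T) :
  (forall q, measurable (F q)) -> measurable (\bigcap_q F q).
Proof.
move=> mF; rewrite -[X in measurable X]setCK setC_bigcap.
by apply: measurableC; apply: bigcupT_measurable_rat => q; exact: measurableC.
Qed.

(** * Measurability of operations on closed sets *)

Section effros.
Context {R : realType}.
Implicit Types (Z : Cl R) (U : set R).

Lemma measurable_hit U : open U ->
  measurable [set Z : Cl R | cval Z `&` U !=set0].
Proof. by move=> oU; apply: sub_sigma_algebra; exists U. Qed.

Lemma cval_inj Z1 Z2 : cval Z1 = cval Z2 -> Z1 = Z2.
Proof.
case: Z1 Z2 => [X cX] [Y cY] /= XY; rewrite XY in cX *.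
by congr CSet; exact: Prop_irrelevance.
Qed.

Lemma closure_meets_open (X U : set R) : open U ->
  closure X `&` U !=set0 <-> X `&` U !=set0.
Proof.
move=> oU; split=> -[x [Xx Ux]]; last by exists x; split => //; exact: subset_closure.
by have [y Hy] := Xx U (open_nbhs_nbhs (conj oU Ux)); exists y.
Qed.

Lemma open_rat_itv (U : set R) (x : R) : open U -> U x ->
  exists p q : rat, [/\ ratr p < x, x < ratr q & `[ratr p, ratr q] `<=` U].
Proof.
move=> oU Ux.
have [e /= e0 He] := open_nbhs_nbhs (conj oU Ux).
have [p] := @rat_in_itvoo R (x - e) x ltac:(lra).
have [q] := @rat_in_itvoo R x (x + e) ltac:(lra).
rewrite !in_itv /= => /andP[q1 q2] /andP[p1 p2].
exists p, q; split => // y /=; rewrite in_itv /= => /andP[y1 y2].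
by apply: He; rewrite /ball /= ltr_distlC; apply/andP; split; lra.
Qed.

(** Taking the closure does not change which open sets are hit, and an open set is a countable union
    of compact rational intervals. Every operation on closed sets below is a [mkc], so its
    measurability reduces to computing the hits of compact intervals. *)
Lemma measurable_mkc d (T : measurableType d) (X : T -> set R) :
  (forall a b : R, measurable [set p | X p `&` `[a, b] !=set0]) ->
  measurable_fun setT (fun p => mkc (X p) : Cl R).
Proof.
move=> mX; apply: (@measurability _ _ T (Cl R) setT _ (hit_sets R)) => //.
move=> _ [_ [U oU <-] <-].
rewrite (_ : _ `&` _ =
  \bigcup_(p : rat) \bigcup_(q in [set q : rat | `[ratr p, ratr q]%classic `<=` U])
     [set x | X x `&` `[ratr p, ratr q] !=set0]); last first.
  apply/seteqP; split=> [x [_ /= /(closure_meets_open _ oU)[y [Xy Uy]]]|].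
    have [p [q [yp yq pq]]] := open_rat_itv oU Uy.
    exists p => //; exists q => //; exists y; split => //=.
    by rewrite in_itv /= !ltW.
  move=> x [p _ [q /= pqU [y [Xy /pqU Uy]]]]; split => //=.
  by apply/closure_meets_open => //; exists y.
apply: bigcupT_measurable_rat => p; rewrite bigcup_mkcond.
apply: bigcupT_measurable_rat => q.
by case: ifPn => _; [exact: mX|exact: measurable0].
Qed.

(** A point strictly between the endpoints leaves room for rationals on both sides, so moving
    endpoints cost only a countable union over fixed rational intervals. *)
Lemma measurable_hit_oo d (T : measurableType d) (F : T -> Cl R) (a b : T -> R) :
  measurable_fun setT F -> measurable_fun setT a -> measurable_fun setT b ->
  measurable [set x | cval (F x) `&` `]a x, b x[ !=set0].
Proof.
move=> mF ma mb.
rewrite (_ : [set _ | _] = \bigcup_(p : rat) \bigcup_(q : rat)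
   ([set x | a x < ratr p] `&` [set x | ratr q < b x] `&`
    F @^-1` [set Z | cval Z `&` `]ratr p, ratr q[ !=set0])); last first.
  apply/seteqP; split=> [x [y [Fy]]|x [p _ [q _ [[/= ap qb] [y [Fy]]]]]] /=.
    rewrite in_itv /= => /andP[ay yb].
    have [p] := rat_in_itvoo ay; have [q] := rat_in_itvoo yb.
    rewrite !in_itv /= => /andP[yq qb] /andP[pa py].
    exists p => //; exists q => //; do ?split => //; exists y; split => //=.
    by rewrite in_itv /= py.
  rewrite in_itv /= => /andP[py yq]; exists y; split => //=.
  by rewrite in_itv /= (lt_trans ap py) (lt_trans yq qb).
apply: bigcupT_measurable_rat => p; apply: bigcupT_measurable_rat => q.
apply: measurableI; first apply: measurableI.
- exact: measurable_set_lt.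
- exact: measurable_set_lt.
- by rewrite -[X in measurable X]setTI; apply: mF => //; apply: measurable_hit.
Qed.

(** If [A] misses [[c, d]], it also misses a neighbourhood of each endpoint, and a slight
    enlargement of the interval adds only points of these neighbourhoods. Thus hitting a closed
    interval is a countable intersection of hits of open ones. *)
Lemma closed_hit_cc (A : set R) (c d : R) : closed A -> c <= d ->
  (forall n : nat, A `&` `]c - n.+1%:R^-1, d + n.+1%:R^-1[ !=set0) ->
  A `&` `[c, d] !=set0.
Proof.
move=> cA cd H; apply: contrapT => A0.
have Ac x : c <= x <= d -> (~` A) x.
  by move=> xcd Ax; apply: A0; exists x; split.
have oA : open (~` A) by rewrite openC.
have [|e1 /= e10 He1] := open_nbhs_nbhs (conj oA (Ac c _)); first by rewrite lexx.
have [|e2 /= e20 He2] := open_nbhs_nbhs (conj oA (Ac d _)); first by rewrite lexx andbT.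
near (\oo : set_system nat) => n.
have n1 : n.+1%:R^-1 < e1 by near: n; exact: (near_infty_natSinv_lt (PosNum e10)).
have n2 : n.+1%:R^-1 < e2 by near: n; exact: (near_infty_natSinv_lt (PosNum e20)).
move: n1 n2 (H n); move: (n.+1%:R^-1) => i n1 n2 [z [Az]]; rewrite /= in_itv /= => /andP[z1 z2].
have [zc|cz] := ltP z c.
  apply: (He1 z) => //; rewrite /ball /= ltr_distlC.
  by rewrite (lt_trans _ z1) ?ltrD2l ?ltrN2 //= (lt_trans zc)// ltrDl.
have [dz|zd] := ltP d z.
  apply: (He2 z) => //; rewrite /ball /= ltr_distlC.
  by rewrite (lt_trans z2) ?ltrD2l ?andbT // (lt_trans _ dz)// ltrBlDr ltrDl.
by apply: (Ac z) => //; rewrite cz zd.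
Unshelve. all: by end_near. Qed.

Lemma measurable_hit_cc d (T : measurableType d) (F : T -> Cl R) (a b : T -> R) :
  measurable_fun setT F -> measurable_fun setT a -> measurable_fun setT b ->
  measurable [set x | cval (F x) `&` `[a x, b x] !=set0].
Proof.
move=> mF ma mb.
rewrite (_ : [set _ | _] = [set x | a x <= b x] `&` \bigcap_(n : nat)
   [set x | cval (F x) `&` `]a x - n.+1%:R^-1, b x + n.+1%:R^-1[ !=set0]); last first.
  apply/seteqP; split=> [x [y [Fy]]|x [/= ab H]] /=.
    rewrite in_itv /= => /andP[ay yb]; split; first exact: le_trans yb.
    move=> n _; exists y; split => //=; rewrite in_itv /=.
    by rewrite (lt_le_trans _ ay) ?(le_lt_trans yb) ?ltrBlDr ?ltrDl ?invr_gt0.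
  by apply: closed_hit_cc => // [|n]; [exact: cval_closed|exact: H].
apply: measurableI.
  exact: measurable_set_le.
apply: bigcapT_measurable => n; apply: measurable_hit_oo => //.
  exact: measurable_funB.
exact: measurable_funD.
Qed.

Lemma measurable_restr d (T : measurableType d) (s : T -> R) (F : T -> Cl R) :
  measurable_fun setT s -> measurable_fun setT F ->
  measurable_fun setT (fun x => restr (s x) (F x)).
Proof.
move=> ms mF; apply: measurable_mkc => a b.
rewrite (_ : [set _ | _] =
  [set x | cval (F x) `&` `[Num.max 0 a, Num.min (s x) b] !=set0]).
  by apply: measurable_hit_cc => //; exact: measurable_minr.
apply/seteqP; split=> x /= [y] /=.
  rewrite !in_itv /= => -[[Fy /andP[y0 ys]] /andP[ya yb]].
  by exists y; rewrite /= in_itv /= ge_max le_min y0 ys ya yb.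
rewrite !in_itv /= ge_max le_min => -[Fy /andP[/andP[y0 ya] /andP[ys yb]]].
by exists y; rewrite /= !in_itv /= y0 ys ya yb.
Qed.

Lemma measurable_rshift d (T : measurableType d) (s t : T -> R) (F : T -> Cl R) :
  measurable_fun setT s -> measurable_fun setT t -> measurable_fun setT F ->
  measurable_fun setT (fun x => Defs.rshift (s x) (t x) (F x)).
Proof.
move=> ms mt mF; apply: measurable_mkc => a b.
rewrite (_ : [set _ | _] = [set x | cval (F x) `&`
    `[Num.max (s x) (a + s x), Num.min (s x + t x) (b + s x)] !=set0]).
  apply: measurable_hit_cc => //.
    by apply: measurable_maxr => //; exact: measurable_funD.
  by apply: measurable_minr => //; exact: measurable_funD.
apply/seteqP; split=> x /= [y] /=.
  move=> [[z [Fz /=]]]; rewrite in_itv /= => /andP[sz zt] <-.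
  rewrite in_itv /= => /andP[ya yb].
  exists z; rewrite /= in_itv /= ge_max le_min sz zt /=; split => //.
  by apply/andP; split; lra.
rewrite !in_itv /= ge_max le_min => -[Fy /andP[/andP[y0 ya] /andP[ys yb]]].
exists (y - s x); rewrite /= !in_itv /=; split; first exists y => //.
  by rewrite /= in_itv /= y0 ys.
by apply/andP; split; lra.
Qed.

Lemma measurable_scale d (T : measurableType d) (t : T -> R) (F : T -> Cl R) :
  (forall x, 0 < t x) ->
  measurable_fun setT t -> measurable_fun setT F ->
  measurable_fun setT (fun x => scale (t x) (F x)).
Proof.
move=> t0 mt mF; apply: measurable_mkc => a b.
rewrite (_ : [set _ | _] = [set x | cval (F x) `&` `[a * t x, b * t x] !=set0]).
  by apply: measurable_hit_cc => //; exact: measurable_funM.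
apply/seteqP; split=> x /= [y] /=.
  move=> [[z Fz <-]]; rewrite in_itv /= ler_pdivlMr// ler_pdivrMr// => zab.
  by exists z; rewrite /= in_itv.
rewrite in_itv /= => -[Fy yab]; exists (y / t x); split; first by exists y.
by rewrite /= in_itv /= ler_pdivlMr// ler_pdivrMr.
Qed.

Lemma measurable_oplus (s : R) :
  measurable_fun setT (oplus s : Cl R * Cl R -> Cl R).
Proof.
apply: measurable_mkc => a b.
rewrite (_ : [set _ | _] = [set Z | cval Z.1 `&` `[a, b] !=set0] `|`
  [set Z | cval Z.2 `&` `[a - s, b - s] !=set0]).
  by apply: measurableU; apply: measurable_hit_cc.
apply/seteqP; split=> -[Z1 Z2] /=.
  move=> [y [[Zy|[z Zz <-]]]] yab; [by left; exists y|right; exists z].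
  split => //=; move: yab; rewrite /= !in_itv /= => /andP[? ?].
  by apply/andP; split; lra.
move=> [[y [Zy yab]]|[y [Zy]]]; first by exists y; split => //; left.
rewrite /= !in_itv /= => /andP[? ?]; exists (s + y); split.
  by right; exists y.
by rewrite /= in_itv /=; apply/andP; split; lra.
Qed.

Lemma cempty_measurable : measurable [set cempty R].
Proof.
rewrite (_ : [set _] = ~` [set Z : Cl R | cval Z `&` setT !=set0]).
  by apply: measurableC; apply: measurable_hit; exact: openT.
apply/seteqP; split=> [Z -> [x []] //|Z /= H].
apply: cval_inj; apply/seteqP; split => // x Zx.
by exfalso; apply: H; exists x.
Qed.

Lemma measurable_nonempty : measurable (nonempty_sets R).
Proof. exact: measurableC cempty_measurable. Qed.

Lemma measurable_Csub (t : R) : measurable (Csub t).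
Proof.
rewrite (_ : Csub t = ~` [set Z : Cl R | cval Z `&` ~` `[0, t] !=set0]).
  apply: measurableC; apply: measurable_hit; rewrite openC; exact: itv_closed.
apply/seteqP; split=> [Z ZC [x [/ZC]] //|Z /= H x Zx].
by apply: contrapT => xt; apply: H; exists x.
Qed.

Lemma measurable_mem (r : R) : measurable [set Z : Cl R | cval Z r].
Proof.
rewrite (_ : [set Z | _] = [set Z : Cl R | cval Z `&` `[r, r] !=set0]).
  exact: (@measurable_hit_cc _ (Cl R) id (cst r) (cst r)).
apply/seteqP; split=> [Z Zr|Z [x [Zx]]].
  by exists r; split => //=; rewrite in_itv /= lexx.
by rewrite /= in_itv /= -eq_le => /eqP ->.
Qed.

(** A closed set is determined by the rational open intervals that it hits, so a singleton is a
    countable intersection of hitting events and their complements. This makes finite sets of atoms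
    measurable. *)
Lemma measurable_cset1 (Z0 : Cl R) : measurable [set Z0].
Proof.
pose H (pq : rat * rat) := [set Z : Cl R | cval Z `&` `]ratr pq.1, ratr pq.2[ !=set0].
have mH pq : measurable (H pq) by apply: measurable_hit; exact: itv_open.
rewrite (_ : [set Z0] = \bigcap_(p : rat) \bigcap_(q : rat)
   (if `[< H (p, q) Z0 >] then H (p, q) else ~` H (p, q))); last first.
  apply/seteqP; split=> [Z -> p _ q _|Z HZ].
    by case: asboolP.
  have HH p q : H (p, q) Z <-> H (p, q) Z0.
    by have := HZ p I q I; case: asboolP.
  have sub (Z1 Z2 : Cl R) : (forall p q, H (p, q) Z1 -> H (p, q) Z2) ->
      cval Z1 `<=` cval Z2.
    move=> H12 x Z1x; apply: contrapT => Z2x.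
    have o2 : open (~` cval Z2) by rewrite openC; exact: cval_closed.
    have [p [q [px xq pq]]] := open_rat_itv o2 Z2x.
    have [|y [Z2y]] := H12 p q.
      by exists x; split => //=; rewrite in_itv /= px xq.
    rewrite /= in_itv /= => /andP[y1 y2]; apply: (pq y) => //=.
    by rewrite in_itv /= !ltW.
  by apply: cval_inj; apply/seteqP; split; apply: sub => p q /HH.
apply: bigcapT_measurable_rat => p; apply: bigcapT_measurable_rat => q.
by case: asboolP => _ //; exact: measurableC.
Qed.

(** * Suprema, anchor and diameter as measurable functions *)

Lemma sup_gtP (X : set R) (a : R) : has_sup X ->
  a < sup X <-> X `&` [set x | a < x] !=set0.
Proof.
move=> sX; split=> [aX|[x [Xx /= ax]]]; last exact: lt_le_trans ax (ub_le_sup sX.2 Xx).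
have e0 : 0 < sup X - a by rewrite subr_gt0.
by have [x Xx] := sup_adherent e0 sX; rewrite subKr => ax; exists x.
Qed.

Lemma has_ubP (X : set R) :
  has_ubound X <-> exists n : nat, ~ (X `&` [set x | n%:R < x] !=set0).
Proof.
split=> [[M XM]|[n Xn]].
  exists (Num.truncn `|M|).+1 => -[x [Xx /= nx]]; have := XM x Xx.
  rewrite leNgt => /negP; apply; apply: le_lt_trans nx.
  by apply: (le_trans (ler_norm M)); exact/ltW/truncnS_gt.
exists n%:R => x Xx; rewrite leNgt; apply/negP => nx; apply: Xn; by exists x.
Qed.

(* [sup] is [0] on sets that are empty or unbounded above. *)
Lemma measurable_sup_hit d (T : measurableType d) (X : T -> set R) :
  (forall a, measurable [set p | X p `&` [set x | a < x] !=set0]) ->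
  measurable_fun setT (fun p => sup (X p)).
Proof.
move=> mX.
have mne : measurable [set p | X p !=set0].
  rewrite (_ : [set _ | _] =
      \bigcup_(n : nat) [set p | X p `&` [set x | - n%:R < x] !=set0]).
    by apply: bigcupT_measurable => n; exact: mX.
  apply/seteqP; split=> [p [x Xx]|p [n _ [x [Xx _]]]]; last by exists x.
  exists (Num.truncn `|x|).+1 => //; exists x; split => //=.
  by rewrite ltrNl (le_lt_trans _ (truncnS_gt _))// -normrN ler_norm.
have mhs : measurable [set p | has_sup (X p)].
  rewrite (_ : [set _ | _] = [set p | X p !=set0] `&`
      \bigcup_(n : nat) ~` [set p | X p `&` [set x | n%:R < x] !=set0]).
    apply: measurableI => //; apply: bigcupT_measurable => n.
    exact/measurableC/mX.
  apply/seteqP; split=> p /=.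
    by move=> [? /has_ubP[n Hn]]; split => //; exists n.
  by move=> [? [n _ Hn]]; split => //; apply/has_ubP; exists n.
apply: (@measurability _ _ T R setT _ (@RGenOInfty.G R)).
  exact: RGenOInfty.measurableE.
move=> _ [_ [a ->] <-]; rewrite setTI.
rewrite (_ : _ @^-1` _ =
  ([set p | has_sup (X p)] `&` [set p | X p `&` [set x | a < x] !=set0]) `|`
  (~` [set p | has_sup (X p)] `&` [set _ | a < 0])).
  apply: measurableU; first by apply: measurableI => //; exact: mX.
  apply: measurableI; first exact: measurableC.
  have [a0|a0] := boolP (a < 0); last first.
    by rewrite (_ : [set _ | _] = set0)//; apply/seteqP; split.
  by rewrite (_ : [set _ | _] = setT)//; apply/seteqP; split.
apply/seteqP; split=> p /=; rewrite in_itv /= andbT.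
  have [sX|nsX] := pselect (has_sup (X p)).
    by move/(sup_gtP _ sX) => ?; left.
  by rewrite sup_out // => ?; right.
move=> [[sX aX]|[nsX a0]]; first by apply/(sup_gtP _ sX).
by rewrite sup_out.
Qed.

Lemma measurable_sup_cval : measurable_fun setT (fun Z : Cl R => sup (cval Z)).
Proof.
by apply: measurable_sup_hit => a; apply: measurable_hit; exact: open_gt.
Qed.

Lemma measurable_inf_cval : measurable_fun setT (fun Z : Cl R => inf (cval Z)).
Proof.
apply: measurableT_comp; first exact: oppr_measurable.
apply: measurable_sup_hit => a.
rewrite (_ : [set _ | _] = [set Z : Cl R | cval Z `&` [set x | x < - a] !=set0]).
  by apply: measurable_hit; exact: open_lt.
apply/seteqP; split=> Z /= [x [/=]].
  by move=> [y Zy <-] ay; exists y; split => //=; rewrite ltrNr.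
by move=> Zx xa; exists (- x); split => /=; [exists x|rewrite ltrNr].
Qed.

(** The default value 0 of [inf] at the empty set absorbs the case distinction. *)
Lemma anchorE : @anchor R = fun Z : Cl R => inf (cval Z).
Proof. by apply/funext => Z; rewrite /anchor; case: asboolP => // ->; rewrite inf0. Qed.

Lemma diamE : @diam R = fun Z : Cl R => sup (cval Z) - inf (cval Z).
Proof.
by apply/funext => Z; rewrite /diam; case: asboolP => // ->; rewrite sup0 inf0 subr0.
Qed.

Lemma measurable_anchor : measurable_fun setT (@anchor R).
Proof. rewrite anchorE; exact: measurable_inf_cval. Qed.

Lemma measurable_diam : measurable_fun setT (@diam R).
Proof.
rewrite diamE; apply: measurable_funB; [exact: measurable_sup_cval|].
exact: measurable_inf_cval.
Qed.

Lemma diam_ge0 (t : R) (Z : Cl R) : Csub t Z -> 0 <= diam Z.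
Proof.
move=> Zt; rewrite /diam; case: asboolP => // Z0.
have [x Zx] : cval Z !=set0 by apply/set0P/eqP.
have lb : has_lbound (cval Z) by exists 0 => y /Zt /=; rewrite in_itv /= => /andP[].
have ub : has_ubound (cval Z) by exists t => y /Zt /=; rewrite in_itv /= => /andP[].
by rewrite subr_ge0; apply: (@le_trans _ _ x); [exact: ge_inf|exact: ub_le_sup].
Qed.

(** * Explicit form of scaling, cutting, shifting and pasting *)

Lemma cval_mkc (X : set R) : closed X -> cval (mkc X) = X.
Proof. by move=> cX; rewrite /= -(closure_id X).1. Qed.

Lemma cval_scale (t : R) Z : 0 < t ->
  cval (scale t Z) = [set x | cval Z (x * t)].
Proof.
move=> t0; rewrite /scale.
rewrite (_ : [set r / t | r in cval Z] = [set x | cval Z (x * t)]).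
  rewrite cval_mkc//; apply: (@preimage_closed R R ( *%R^~ t)).
    by move=> ? _; exact: mulrr_continuous.
  exact: cval_closed.
apply/seteqP; split=> [_ [r Zr <-]|x /= Zx]; first by rewrite /= divfK ?gt_eqF.
by exists (x * t) => //; rewrite mulfK ?gt_eqF.
Qed.

Lemma scaleK (t : R) : 0 < t -> cancel (scale t) (@scale R t^-1).
Proof.
move=> t0 Z; apply: cval_inj; rewrite cval_scale ?invr_gt0// cval_scale//.
by apply/seteqP; split => x /=; rewrite divfK ?gt_eqF.
Qed.

Lemma scale_Csub (t : R) Z : 0 < t -> Csub t Z -> Csub 1 (scale t Z).
Proof.
move=> t0 Zt x; rewrite cval_scale//= => /Zt /=; rewrite !in_itv/=.
by rewrite pmulr_lge0// -ler_pdivlMr// divff ?gt_eqF.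
Qed.

Lemma cval_restr (s : R) Z : cval (restr s Z) = cval Z `&` `[0, s].
Proof. by apply: cval_mkc; apply: closedI; [exact: cval_closed|exact: itv_closed]. Qed.

Lemma shift_closed (s : R) (X : set R) : closed X -> closed [set x | X (x + s)].
Proof.
move=> cX; apply: (@preimage_closed R R (fun x => x + s)) => // x _.
by apply: cvgD => //; exact: cvg_cst.
Qed.

Lemma cval_rshift (s t : R) Z :
  cval (Defs.rshift s t Z) = [set x | cval Z (x + s) /\ 0 <= x <= t].
Proof.
rewrite /Defs.rshift (_ : [set _ | _ in _] = [set x | (cval Z `&` `[s, s + t]) (x + s)]).
  rewrite cval_mkc; last first.
    by apply: shift_closed; apply: closedI; [exact: cval_closed|exact: itv_closed].
  apply/seteqP; split=> x /=; rewrite in_itv /=.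
    by move=> [? /andP[? ?]]; split => //; apply/andP; split; lra.
  by move=> [? /andP[? ?]]; split => //; apply/andP; split; lra.
apply/seteqP; split=> [_ [x Zx <-]|x Zx]; first by rewrite /= subrK.
by exists (x + s) => //; rewrite addrK.
Qed.

Lemma cval_oplus (s : R) (Z1 Z2 : Cl R) :
  cval (oplus s (Z1, Z2)) = cval Z1 `|` [set x | cval Z2 (x - s)].
Proof.
rewrite /oplus /= (_ : [set s + x | x in cval Z2] = [set x | cval Z2 (x - s)]).
  by rewrite -(closure_id _).1//; apply: closedU;
    [exact: cval_closed|apply: shift_closed; exact: cval_closed].
apply/seteqP; split=> [_ [x Zx <-]|x Zx]; first by rewrite /= [s + x]addrC addrK.
by exists (x - s) => //; rewrite addrC subrK.
Qed.

(** The shifted copy s + Z2 lies to the right of s, so it can meet [0, s] only at s itself, which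
    would put 0 in Z2. The companion fact for [rshift] excludes s from Z1 in the same way. *)
Lemma restr_oplus (s t : R) (Z1 Z2 : Cl R) :
  Csub s Z1 -> Csub t Z2 -> ~ cval Z2 0 -> restr s (oplus s (Z1, Z2)) = Z1.
Proof.
move=> Z1s Z2t Z20; apply: cval_inj; rewrite cval_restr cval_oplus.
apply/seteqP; split=> [x [[//|/= Z2x]]|x Z1x]; last by split; [left|exact: Z1s].
rewrite in_itv /= => /andP[x0 xs]; have := Z2t _ Z2x.
rewrite /= in_itv /= => /andP[x1 x2]; exfalso; apply: Z20.
by rewrite (_ : 0 = x - s)//; lra.
Qed.

Lemma rshift_oplus (s t : R) (Z1 Z2 : Cl R) :
  Csub s Z1 -> Csub t Z2 -> ~ cval Z1 s ->
  Defs.rshift s t (oplus s (Z1, Z2)) = Z2.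
Proof.
move=> Z1s Z2t Z1Ns; apply: cval_inj; rewrite cval_rshift cval_oplus.
apply/seteqP; split=> [x [[/= Z1x|/=]]|x Z2x /=]; last 2 first.
- by rewrite addrK.
- by rewrite addrK; split; [right|have := Z2t _ Z2x; rewrite /= in_itv].
move=> /andP[x0 xt]; have := Z1s _ Z1x; rewrite /= in_itv /= => /andP[? ?].
by exfalso; apply: Z1Ns; rewrite (_ : s = x + s)//; lra.
Qed.

End effros.

(** * Measures with a density *)

Section density.
Context d (T : measurableType d) (R : realType).
Local Open Scope ereal_scope.
Implicit Types (m : {measure set T -> \bar R}) (D : T -> R).

(** The set functions of the statement are given by formulas. Identifying them, as functions, with a
    structured measure opens them to measure theory by rewriting. *)
Lemma ex_finite_measure (m : set T -> \bar R) :
  m set0 = 0 -> (forall A, 0 <= m A) -> semi_sigma_additive m -> m setT < +oo ->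
  exists M : {finite_measure set T -> \bar R}, m = M :> (set T -> \bar R).
Proof.
move=> m0 mge0 madd mfin.
pose i1 := isMeasure.Build d T R m m0 mge0 madd.
pose M1 : {measure set T -> \bar R} := HB.pack m i1.
have fM : fin_num_fun M1.
  move=> A mA; rewrite ge0_fin_numE ?measure_ge0//.
  by apply: le_lt_trans mfin; apply: (@le_measure _ _ _ M1) => //; rewrite inE.
pose i2 := Measure_isFinite.Build d T R M1 fM.
pose M2 : {finite_measure set T -> \bar R} := HB.pack m M1 i2.
by exists M2.
Qed.

Lemma null_dominatesP (m1 m2 : set T -> \bar R) m : m = m2 :> (set T -> \bar R) ->
  m1 `<< m2 <-> forall A, measurable A -> m2 A = 0 -> m1 A = 0.
Proof. by move=> <-; exact: null_content_dominatesP. Qed.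

Lemma ae_dominates m1 m2 (P : T -> Prop) : m1 `<< m2 ->
  {ae m2, forall x, P x} -> {ae m1, forall x, P x}.
Proof.
move=> /(null_dominatesP _ (erefl _)) m12 [A [mA A0 PA]]; exists A; split => //.
exact: m12.
Qed.

Lemma pos_integral_eq0 m (f : T -> R) (A : set T) : measurable A ->
  measurable_fun setT f -> (forall x, 0 < f x)%R ->
  \int[m]_(x in A) (f x)%:E = 0 <-> m A = 0.
Proof.
move=> mA mf f0.
have mfA : measurable_fun A (fun x => (f x)%:E).
  by apply/measurable_EFinP; exact: measurable_funTS.
split=> [i0|A0]; last exact: null_set_integral.
have : ae_eq m A (fun x => (f x)%:E) (cst 0).
  apply/ae_eq_integral_abs => //; rewrite -[RHS]i0; apply: eq_integral => x _.
  by rewrite gee0_abs// lee_fin ltW.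
move=> H; apply: measure_negligible => //.
apply: negligibleS H => x /= Ax /(_ Ax)[] fx0.
by have := f0 x; rewrite fx0 ltxx.
Qed.

(** [is_density] does not ask for a nonnegative function, and versions of densities are arbitrary.
    On the set where [D] is negative the integral is both nonnegative, being a value of [m1], and
    nonpositive, so that set is null. *)
Lemma density_ae_ge0 (m1 : set T -> \bar R) m D :
  is_density m1 m D -> (forall A, 0 <= m1 A) -> {ae m, forall x, (0 <= D x)%R}.
Proof.
move=> [mD HD] m10.
pose A := [set x | (D x < 0)%R].
have mA : measurable A by exact: measurable_set_lt.
have mDA : measurable_fun A (fun x => (D x)%:E).
  by apply/measurable_EFinP; exact: measurable_funTS.
have i0 : \int[m]_(x in A) `|(D x)%:E| = 0.
  apply/eqP; rewrite eq_le integral_ge0 ?andbT// -[leLHS]oppeK -integral_ge0N//.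
  rewrite leeNl oppe0 (_ : \int[m]_(x in A) _ = m1 A)// HD//.
  apply: eq_integral => x; rewrite inE /= => Dx0.
  by rewrite ltr0_norm// opprK.
move/ae_eq_integral_abs : i0 => /(_ mA mDA) [N [mN N0 HN]].
exists N; split => // x /= Dx; apply: HN => /= H; apply: Dx.
by rewrite leNgt; apply/negP => Dx; have [Dx0] := H Dx; rewrite Dx0 ltxx in Dx.
Qed.

Lemma density_integrable (m1 : set T -> \bar R) m D :
  is_density m1 m D -> (forall A, 0 <= m1 A) -> m1 setT < +oo ->
  m.-integrable setT (fun x => (D x)%:E).
Proof.
move=> HD m10 fm1; have D0 := density_ae_ge0 HD m10.
case: HD => mD HD; apply/integrableP; split; first exact/measurable_EFinP.
rewrite (_ : \int[m]_x _ = \int[m]_x (D x)%:E) -?HD//.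
rewrite HD//; apply: (@ae_eq_integral _ _ _ m setT) => //.
- by apply/measurable_EFinP; exact: measurableT_comp.
- exact/measurable_EFinP.
- by apply: filterS D0 => x Dx0 _ /=; rewrite ger0_norm.
Qed.

(** This replaces the arbitrary versions of [Delta] in the definition of isomorphism by the explicit
    ones. *)
Lemma density_ae_unique (m1 : set T -> \bar R) m D1 D2 :
  is_density m1 m D1 -> is_density m1 m D2 ->
  (forall A, 0 <= m1 A) -> m1 setT < +oo ->
  {ae m, forall x, D1 x = D2 x}.
Proof.
move=> H1 H2 m10 fm1.
have iD1 := density_integrable H1 m10 fm1.
case: H1 H2 => mD1 H1 [mD2 H2].
have : ae_eq m setT (EFin \o D1) (EFin \o D2).
  apply: integral_ae_eq => //; first exact/measurable_EFinP.
  by move=> E _ mE; rewrite -H1// H2.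
by apply: filterS => x /(_ I)[].
Qed.

(** [D] agrees almost everywhere with the Radon-Nikodym derivative, for which the change of
    variables is known. *)
Lemma density_integral (m1 : {finite_measure set T -> \bar R})
    (m2 : {sigma_finite_measure set T -> \bar R}) D (f : T -> \bar R) E :
  is_density m1 m2 D -> measurable E -> measurable_fun setT f ->
  (forall x, 0 <= f x) ->
  \int[m1]_(x in E) f x = \int[m2]_(x in E) (f x * (D x)%:E).
Proof.
move=> HD mE mf f0; have iD := density_integrable HD (measure_ge0 m1)
  (fin_num_fun_lty (fin_num_measure m1)).
case: (HD) => mD HDA.
have dom : m1 `<< m2.
  apply/null_content_dominatesP => A mA A0; rewrite HDA//.
  by apply: null_set_integral => //; apply: measurable_funTS; exact/measurable_EFinP.
rewrite -(Radon_Nikodym_SigmaFinite.change_of_variables dom)//; last first.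
  exact: measurable_funTS.
have mRN := measurable_int _ (Radon_Nikodym_SigmaFinite.f_integrable dom).
have aeD : ae_eq m2 setT (EFin \o D) (Radon_Nikodym_SigmaFinite.f m1 m2).
  apply: integral_ae_eq => // A _ mA.
  by rewrite -HDA// -Radon_Nikodym_SigmaFinite.f_integral.
apply: ae_eq_integral => //.
- by apply: measurable_funTS; apply: emeasurable_funM.
- by apply: measurable_funTS; apply: emeasurable_funM => //; exact/measurable_EFinP.
- by apply: filterS aeD => x /(_ I) /= ->.
Qed.
End density.

Lemma density_prod d1 d2 (T1 : measurableType d1) (T2 : measurableType d2)
    (R : realType) (n1 : {finite_measure set T1 -> \bar R})
    (n2 : {finite_measure set T2 -> \bar R})
    (m1 : {sigma_finite_measure set T1 -> \bar R})
    (m2 : {sigma_finite_measure set T2 -> \bar R}) (g1 : T1 -> R) (g2 : T2 -> R) :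
  (forall x, 0 <= g1 x) -> (forall x, 0 <= g2 x) ->
  is_density n1 m1 g1 -> is_density n2 m2 g2 ->
  is_density (n1 \x n2)%E (m1 \x m2)%E (fun z => g1 z.1 * g2 z.2).
Proof.
move=> g10 g20 D1 D2; case: (D1) (D2) => mg1 _ [mg2 _].
have mg : measurable_fun setT (fun z : T1 * T2 => g1 z.1 * g2 z.2).
  by apply: measurable_funM; exact: measurableT_comp.
split => // A mA.
rewrite integral_mkcond fubini_tonelli1//; last 2 first.
- by apply/(measurable_restrictT _ _).1 => //; apply/measurable_EFinP; exact: measurable_funTS.
- by move=> z; rewrite patchE; case: ifPn => // _; rewrite lee_fin mulr_ge0.
rewrite /product_measure1 (density_integral D1)//; last first.
  exact: measurable_fun_xsection.
apply: eq_integral => x _; rewrite /fubini_F /=.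
have mxA := measurable_xsection x mA.
transitivity ((\int[m2]_(y in xsection A x) (g2 y)%:E) * (g1 x)%:E)%E.
  by case: D2 => _ ->.
rewrite -ge0_integralZr//; last 3 first.
- by apply: measurable_funTS; exact/measurable_EFinP.
- by move=> y _; rewrite lee_fin.
- by rewrite lee_fin.
rewrite integral_mkcond; apply: eq_integral => y _; rewrite !patchE.
rewrite (_ : (y \in xsection A x) = ((x, y) \in A)) ?mem_xsection//.
by case: ifPn => // _; rewrite -EFinM mulrC.
Qed.

Lemma measurable_invr d (T : measurableType d) (R : realType) (f : T -> R) :
  (forall x, 0 < f x) -> measurable_fun setT f ->
  measurable_fun setT (fun x => (f x)^-1).
Proof.
move=> f0 mf; rewrite (_ : (fun x => _) = fun x => expR (- ln (f x))).
  apply: measurableT_comp; first exact: measurable_expR.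
  apply: measurableT_comp; first exact: oppr_measurable.
  by apply: measurableT_comp; first exact: measurable_ln.
by apply/funext => x; rewrite expRN lnK// posrE.
Qed.

Lemma measurable_fun_sqrt d (T : measurableType d) (R : realType) (f : T -> R) :
  measurable_fun setT f -> measurable_fun setT (fun x => Num.sqrt (f x)).
Proof.
move=> mf; apply: (measurableT_comp _ mf).
by apply: continuous_measurable_fun; exact: sqrt_continuous.
Qed.

Lemma measurable_integral_family d d' (X : measurableType d) (Y : measurableType d')
    (R : realType) (M : X -> {measure set Y -> \bar R}) (f : X * Y -> \bar R) :
  (exists r : R, forall x, M x setT < r%:E)%E ->
  (forall U, measurable U -> measurable_fun setT (M ^~ U)) ->
  (forall z, 0 <= f z)%E -> measurable_fun setT f ->
  measurable_fun setT (fun x => \int[M x]_y f (x, y))%E.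
Proof.
move=> fM mM f0 mf.
pose k1 := isKernel.Build _ _ X Y R M mM.
pose K1 : R.-ker X ~> Y := HB.pack M k1.
pose k2 := Kernel_isFinite.Build _ _ X Y R K1 fM.
pose K2 : R.-fker X ~> Y := HB.pack (K1 : X -> {measure set Y -> \bar R}) K1 k2.
exact: (@measurable_fun_integral_finite_kernel _ _ X Y R f K2).
Qed.

(** * Families indexed by [t > 0] as kernels *)

(* Makes families that are only constrained for [t > 0] total in [t]. *)
Definition posr {R : realType} (t : R) : R := if 0 < t then t else 1.

Lemma measure_supp d (T : measurableType d) (R : realType)
    (m : {measure set T -> \bar R}) (A C : set T) :
  measurable A -> measurable C -> m (~` C) = 0%E -> m A = m (A `&` C).
Proof.
move=> mA mC C0; rewrite -[in LHS](setIT A) -(setUv C) setIUr measureU//; last 3 first.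
- exact: measurableI.
- by apply: measurableI => //; exact: measurableC.
- by rewrite setIACA setICr setI0.
rewrite [X in (_ + X)%E](_ : _ = 0%E) ?adde0//.
by apply: (subset_measure0 _ _ _ C0) => //;
  [apply: measurableI => //|]; exact: measurableC.
Qed.

Section family.
Context {R : realType}.
Implicit Types (mu nu : R -> probability (Cl R) R) (A : set (Cl R)).

Lemma posr_gt0 (t : R) : 0 < posr t.
Proof. by rewrite /posr; case: ifPn. Qed.

Lemma posr_id (t : R) : 0 < t -> posr t = t.
Proof. by rewrite /posr => ->. Qed.

Lemma measurable_posr : measurable_fun setT (@posr R).
Proof.
by apply: measurable_fun_if => //; exact: measurable_fun_ltr.
Qed.

Lemma measurable_fun_posr d (T : measurableType d) (F : R -> T) :
  measurable_fun (`]0, +oo[ : set R) F -> measurable_fun setT (F \o posr).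
Proof.
move=> mF; apply: (measurable_comp _ _ mF measurable_posr) => //.
by move=> _ [t _ <-] /=; rewrite in_itv /= andbT posr_gt0.
Qed.

Lemma measurable_posr_fun d (T : measurableType d) (F : R -> T) :
  measurable_fun setT (F \o posr) -> measurable_fun (`]0, +oo[ : set R) F.
Proof.
move=> mF; apply: (eq_measurable_fun (F \o posr)).
  by move=> t; rewrite inE /= in_itv /= andbT => t0; rewrite posr_id.
exact: measurable_funTS.
Qed.

Lemma measurable_scale_fix (t : R) : 0 < t ->
  measurable_fun setT (scale t : Cl R -> Cl R).
Proof. by move=> t0; exact: (@measurable_scale _ _ (Cl R) (cst t) id). Qed.

(** Condition (iv a) gives measurability in [t] only on a generating ring. A ring is closed under
    intersection, as B [\] (B [\] C) shows, and the sets with measurable [t]-dependence form a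
    lambda-system on [Csub 1] because the rescaled laws all give [Csub 1] mass 1. The monotone class
    argument then covers the whole sigma-field. *)
Lemma MFF_scale_kernel mu A : MFF mu -> measurable A ->
  measurable_fun setT (fun t => mu (posr t) (scale (posr t) @^-1` A)).
Proof.
move=> [supp _ _ _ [[Rg [_ [Rg0 RgU RgD] RgS Rgs mRg]] _]] mA.
pose m t (B : set (Cl R)) := mu (posr t) (scale (posr t) @^-1` B).
have mpre t (B : set (Cl R)) : measurable B -> measurable (scale (posr t) @^-1` B).
  by move=> mB; rewrite -[X in measurable X]setTI;
    apply: measurable_scale_fix => //; exact: posr_gt0.
pose H := [set B | [/\ measurable B, B `<=` Csub 1 & measurable_fun setT (m ^~ B)]].
have RgI : setI_closed Rg.
  by move=> B C RB RC; rewrite -setDD; apply: (RgD) => //; exact: RgD.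
have full t : m t (Csub 1) = 1%E.
  apply/eqP; rewrite eq_le; apply/andP; split.
    by apply: probability_le1; apply: mpre; exact: measurable_Csub.
  rewrite -(@probability_setT _ _ _ (mu (posr t))).
  rewrite -(setUv (Csub (posr t))) measureU//; last 3 first.
  - exact: measurable_Csub.
  - by apply: measurableC; exact: measurable_Csub.
  - by rewrite setICr.
  rewrite [X in (_ + X)%E](_ : _ = 0%E); last exact: (supp _ (posr_gt0 t)).
  rewrite adde0; apply: le_measure; rewrite ?inE.
  - exact: measurable_Csub.
  - by apply: mpre; exact: measurable_Csub.
  - by move=> Z; apply: scale_Csub; exact: posr_gt0.
have lamH : lambda_system (Csub 1) H.
  split.
  - by move=> B [].
  - split => //; first exact: measurable_Csub.
    by rewrite (_ : m ^~ _ = cst 1%E)//; apply/funext => t; exact: full.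
  - move=> B C CB [mB B1 mmB] [mC C1 mmC]; split.
    + exact: measurableD.
    + by move=> Z [/B1].
    + rewrite (_ : m ^~ _ = fun t => (m t B - m t C)%E).
        exact: emeasurable_funB.
      apply/funext => t; rewrite /m (_ : _ @^-1` (B `\` C) =
        scale (posr t) @^-1` B `\` scale (posr t) @^-1` C)// measureD.
      * by rewrite setIidr//; exact: preimage_subset.
      * exact: mpre.
      * exact: mpre.
      * by rewrite (le_lt_trans (probability_le1 _ _)) ?ltry//; exact: mpre.
  - move=> F ndF HF; split.
    + by apply: bigcupT_measurable => n; case: (HF n).
    + by apply: bigcup_sub => n _; case: (HF n).
    + apply: (emeasurable_fun_cvg (fun n => m ^~ (F n))).
        by move=> n; case: (HF n).
      move=> t _; rewrite /m preimage_bigcup; apply: nondecreasing_cvg_mu.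
      * by move=> n; apply: mpre; case: (HF n).
      * by apply: bigcupT_measurable => n; apply: mpre; case: (HF n).
      * move=> i j ij; apply/subsetPset; apply: preimage_subset.
        exact/subsetPset/ndF.
have RgH : Rg `<=` H.
  move=> B RB; have [mB B1] := RgS _ RB; split => //.
  by apply: (@measurable_fun_posr _ _ (fun t => mu t (scale t @^-1` B))); exact: mRg.
have sub : <<s Csub 1, Rg >> `<=` H.
  apply: lambda_system_subset => // X; rewrite Rgs => -[B mB <-].
  exact: subIsetr.
(* The ring generates only the trace sigma-field on [Csub 1]. Cutting [A] down to [Csub 1] loses no
   mass, because [mu t] is concentrated on [Csub t] and scaling maps [Csub t] into [Csub 1]. *)
have [mA1 _ mmA] : H (A `&` Csub 1) by apply: sub; rewrite Rgs; exists A.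
rewrite (_ : (fun t => _) = m ^~ (A `&` Csub 1))//.
apply/funext => t; rewrite /m.
have supt := supp _ (posr_gt0 t).
have mC := measurable_Csub (posr t).
rewrite (measure_supp _ mC supt); last exact: mpre.
rewrite [RHS](measure_supp _ mC supt); last exact: mpre.
congr (mu _ _); apply/seteqP; split=> Z /= [ZA Zt]; split => //.
  by split => //; apply: scale_Csub => //; exact: posr_gt0.
by case: ZA.
Qed.

(** Rescaling moves the laws to [0, 1], where they form a kernel. The integrand is composed with the
    inverse scaling, so the change of variables returns the original integral. *)
Lemma measurable_integral_MFF d (T : measurableType d) mu (p : T -> R)
    (F : T * Cl R -> \bar R) : MFF mu -> measurable_fun setT p ->
  (forall z, 0 <= F z)%E -> measurable_fun setT F ->
  measurable_fun setT (fun x => \int[mu (posr (p x))]_Z F (x, Z))%E.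
Proof.
move=> Mmu mp F0 mF.
have ms x := measurable_scale_fix (posr_gt0 (p x)).
pose X x : {mfun Cl R >-> Cl R} := mfun_Sub (mem_set (ms x)).
pose M x : {measure set (Cl R) -> \bar R} := distribution (mu (posr (p x))) (X x).
have mpp : measurable_fun setT (fun x => posr (p x)).
  exact: (measurableT_comp measurable_posr).
pose G (z : T * Cl R) := F (z.1, scale (posr (p z.1))^-1 z.2).
have mG : measurable_fun setT G.
  apply: (measurableT_comp mF); apply: measurable_fun_pair => //.
  apply: measurable_scale => [z| |//]; first by rewrite invr_gt0 posr_gt0.
  apply: measurable_invr => [z|]; first exact: posr_gt0.
  exact: (measurableT_comp mpp).
rewrite (_ : (fun x => _) = fun x => (\int[M x]_Z G (x, Z))%E); last first.
  apply/funext => x; rewrite /M ge0_integral_distribution//.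
    by apply: eq_integral => Z _; rewrite /G /= scaleK// posr_gt0.
    exact: (measurableT_comp mG (pair1_measurable x)).
  by move=> Z; exact: F0.
apply: (@measurable_integral_family _ _ T (Cl R) R M G) => //.
- exists 2 => x; rewrite (le_lt_trans (probability_le1 (M x) measurableT))//.
  by rewrite lte_fin ltr1n.
- by move=> U mU; exact: (measurableT_comp (MFF_scale_kernel Mmu mU) mp).
- by move=> z; exact: F0.
Qed.

Lemma measurable_Rintegral_MFF mu (F : R * Cl R -> R) : MFF mu ->
  measurable_fun setT F ->
  measurable_fun setT (fun t => fine (\int[mu (posr t)]_Z (F (t, Z))%:E)%E).
Proof.
move=> Mmu mF; apply: measurableT_comp; first exact: fine_measurable.
have mE : measurable_fun setT (EFin \o F) by exact/measurable_EFinP.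
rewrite (_ : (fun t => _) = fun t =>
  (\int[mu (posr t)]_Z ((EFin \o F)^\+ (t, Z)) -
   \int[mu (posr t)]_Z ((EFin \o F)^\- (t, Z)))%E); last first.
  apply/funext => t; rewrite [LHS]integralE.
  by congr (_ - _)%E; apply: eq_integral => Z _; rewrite ?funeposE ?funenegE.
apply: emeasurable_funB; apply: (measurable_integral_MFF Mmu) => //.
- exact: measurable_funepos.
- exact: measurable_funeneg.
Qed.
End family.

Lemma ex_pushforward d1 d2 (T1 : measurableType d1) (T2 : measurableType d2)
    (R : realType) (m : {measure set T1 -> \bar R}) (f : T1 -> T2) :
  (m setT < +oo)%E -> measurable_fun setT f ->
  exists M : {finite_measure set T2 -> \bar R},
    pushforward m f = M :> (set T2 -> \bar R).
Proof.
move=> fm mf.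
have mpre (B : set T2) : measurable B -> measurable (f @^-1` B).
  by move=> mB; rewrite -[X in measurable X]setTI; exact: mf.
apply: ex_finite_measure => //.
- by rewrite /pushforward preimage_set0 measure0.
- by move=> A; exact: measure_ge0.
- move=> F mF tF mUF; rewrite /pushforward preimage_bigcup.
  apply: measure_semi_sigma_additive.
  + by move=> n; exact: mpre.
  + apply/trivIsetP => i j _ _ ij; rewrite -preimage_setI.
    by move/trivIsetP : tF => ->//; rewrite preimage_set0.
  + by rewrite -preimage_bigcup; exact: mpre.
Qed.

Lemma density_mequiv d (T : measurableType d) (R : realType)
    (m1 : set T -> \bar R) (m2 : {measure set T -> \bar R}) (D : T -> R) :
  is_density m1 m2 D -> (forall x, 0 < D x) ->
  forall A, measurable A -> m1 A = 0%E <-> m2 A = 0%E.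
Proof.
by move=> [mD HD] D0 A mA; rewrite HD//; exact: pos_integral_eq0.
Qed.

Lemma mequivP d (T : measurableType d) (R : realType)
    (m1 m2 : set T -> \bar R) (M1 M2 : {measure set T -> \bar R}) :
  m1 = M1 :> (set T -> \bar R) -> m2 = M2 :> (set T -> \bar R) ->
  mequiv m1 m2 <-> forall A, measurable A -> m1 A = 0%E <-> m2 A = 0%E.
Proof.
move=> E1 E2; split=> [[H12 H21] A mA|H].
  move/(null_dominatesP _ (esym E2)) : H12 => H12.
  move/(null_dominatesP _ (esym E1)) : H21 => H21.
  by split; [exact: H21|exact: H12].
by split; [apply/(null_dominatesP _ (esym E2))|apply/(null_dominatesP _ (esym E1))];
  move=> A mA /H; apply.
Qed.

Lemma prod_probability_fin d1 d2 (T1 : measurableType d1) (T2 : measurableType d2)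
    (R : realType) (P1 : probability T1 R) (P2 : probability T2 R) :
  ((P1 \x P2) setT < +oo)%E.
Proof.
rewrite -setXTT; apply: (@le_lt_trans _ _ (P1 setT * P2 setT)%E).
  by rewrite -(product_measure1E P1 P2 measurableT measurableT).
by rewrite !probability_setT mule1 ltry.
Qed.

(** * Changing a factorizing family by a positive density *)

(* Evaluated at [Z1 u (s + Z2)], this is almost surely [g_s(Z1) g_t(Z2)]. *)
Definition split_density {R : realType} (g : R * Cl R -> R) (s t : R) (Z : Cl R) : R :=
  g (s, restr s Z) * g (t, Defs.rshift s t Z).

Section equivalent_family.
Context {R : realType}.
Variables (mu nu : R -> probability (Cl R) R) (g : R * Cl R -> R).
Hypothesis Mmu : MFF mu.
Hypothesis mg : measurable_fun setT g.
Hypothesis g0 : forall z, 0 < g z.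
Hypothesis dens : forall t : R, 0 < t -> is_density (nu t) (mu t) (fun Z => g (t, Z)).

Lemma measurable_sec (t : R) : measurable_fun setT (fun Z : Cl R => g (t, Z)).
Proof. exact: (measurableT_comp mg (pair1_measurable t)). Qed.

Lemma family_null (t : R) (A : set (Cl R)) : 0 < t -> measurable A ->
  nu t A = 0%E <-> mu t A = 0%E.
Proof. by move=> t0 mA; apply: (density_mequiv (dens t0)). Qed.

Lemma family_mequiv (t : R) : 0 < t -> mequiv (nu t) (mu t).
Proof.
by move=> t0; apply/(mequivP (erefl _) (erefl _)) => A; exact: family_null.
Qed.

Lemma measurable_split_density d (T : measurableType d) (s t : T -> R) (F : T -> Cl R) :
  measurable_fun setT s -> measurable_fun setT t -> measurable_fun setT F ->
  measurable_fun setT (fun x => split_density g (s x) (t x) (F x)).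
Proof.
move=> ms mt mF; apply: measurable_funM; apply: (measurableT_comp mg).
  by apply: measurable_fun_pair => //; exact: measurable_restr.
by apply: measurable_fun_pair => //; exact: measurable_rshift.
Qed.

(** The pasted set fails to determine its two pieces only if s belongs to Z1 or 0 to Z2. Condition
    (ii) makes both events null, and the support condition discards sets outside the two
    intervals. *)
Lemma split_density_oplus_ae (s t : R) : 0 < s -> 0 < t ->
  {ae (mu s \x mu t)%E, forall z, split_density g s t (oplus s z) = g (s, z.1) * g (t, z.2)}.
Proof.
move=> s0 t0; case: Mmu => supp _ nomem _ _.
pose B1 := ~` Csub s `|` [set Z : Cl R | cval Z s].
pose B2 := ~` Csub t `|` [set Z : Cl R | cval Z 0].
have mB1 : measurable B1.
  by apply: measurableU; [apply: measurableC; exact: measurable_Csub|exact: measurable_mem].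
have mB2 : measurable B2.
  by apply: measurableU; [apply: measurableC; exact: measurable_Csub|exact: measurable_mem].
have n1 : mu s B1 = 0%E.
  apply: null_set_setU; [|exact: measurable_mem|exact: supp|apply: nomem => //].
    by apply: measurableC; exact: measurable_Csub.
  by rewrite lexx ltW.
have n2 : mu t B2 = 0%E.
  apply: null_set_setU; [|exact: measurable_mem|exact: supp|apply: nomem => //].
    by apply: measurableC; exact: measurable_Csub.
  by rewrite lexx ltW.
exists (B1 `*` setT `|` setT `*` B2); split.
- by apply: measurableU; exact: measurableX.
- apply: null_set_setU; [exact: measurableX|exact: measurableX| |].
    transitivity (mu s B1 * mu t setT)%E; first exact: product_measure1E.
    by rewrite n1 mul0e.
  transitivity (mu s setT * mu t B2)%E; first exact: product_measure1E.
  by rewrite n2 mule0.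
- move=> -[Z1 Z2] /= H; apply: contrapT => /not_orP /= [H1 H2]; apply: H.
  have /not_orP[/contrapT Z1s Z1Ns] : ~ B1 Z1 by move=> ?; apply: H1.
  have /not_orP[/contrapT Z2t Z2N0] : ~ B2 Z2 by move=> ?; apply: H2.
  by rewrite /split_density (restr_oplus Z1s Z2t)// (rshift_oplus Z1s Z2t).
Qed.

(** Chain rule: the product law of [nu] has density g_s g_t with respect to that of [mu], and by the
    almost sure splitting this density is a function of the pasted set. It therefore passes through
    the pushforward, where [D] converts to [mu (s + t)] and division by g_(s+t) converts to
    [nu (s + t)]. *)
Lemma Delta_transfer (s t : R) (D : Cl R -> R) : 0 < s -> 0 < t ->
  Delta_of mu s t D -> (forall Z, 0 <= D Z) ->
  Delta_of nu s t (fun Z => D Z * split_density g s t Z / g (s + t, Z)).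
Proof.
move=> s0 t0 HD D0.
have st0 : 0 < s + t by rewrite addr_gt0.
have mpsi : measurable_fun setT (split_density g s t).
  exact: (@measurable_split_density _ _ (cst s) (cst t) id).
have psi0 Z : 0 <= split_density g s t Z by rewrite mulr_ge0 ?ltW.
have mD : measurable_fun setT D by case: HD.
have mDg : measurable_fun setT (fun Z => D Z * split_density g s t Z / g (s + t, Z)).
  apply: measurable_funM; first exact: measurable_funM.
  apply: measurable_invr => //; exact: measurable_sec.
split => // A mA.
have [M ME] := ex_pushforward (prod_probability_fin (mu s) (mu t)) (measurable_oplus s).
rewrite (density_integral (dens st0))//; last 2 first.
- exact/measurable_EFinP.
- by move=> Z; rewrite lee_fin; apply: divr_ge0; [exact: mulr_ge0|exact: ltW].
(* Passing from [nu (s + t)] to [mu (s + t)] produces the factor g_(s+t) that cancels the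
   denominator. *)
transitivity (\int[mu (s + t)]_(Z in A) ((split_density g s t Z)%:E * (D Z)%:E))%E; last first.
  by apply: eq_integral => Z _; rewrite -!EFinM divfK ?gt_eqF// mulrC.
rewrite -(@density_integral _ _ _ M (mu (s + t)) D
  (fun Z => (split_density g s t Z)%:E))//; last 2 first.
- by rewrite -ME.
- exact/measurable_EFinP.
rewrite -ME ge0_integral_pushforward//; last 3 first.
- exact: measurable_oplus.
- by apply: measurable_funTS; exact/measurable_EFinP.
- by move=> Z _; rewrite lee_fin.
rewrite /pushforward.
have g0' (u : R) Z : 0 <= g (u, Z) by exact: ltW.
have mpre : measurable (oplus s @^-1` A).
  by rewrite -[X in measurable X]setTI; exact: measurable_oplus.
have [mgg ->//] := density_prod (g0' s) (g0' t) (dens s0) (dens t0).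
apply: (@ae_eq_integral _ _ _ (mu s \x mu t)%E) => //.
- by apply: measurable_funTS; apply/measurable_EFinP.
- apply: measurable_funTS; apply/measurable_EFinP.
  by apply: (measurableT_comp mpsi); exact: measurable_oplus.
- by apply: filterS (split_density_oplus_ae s0 t0) => z Hz _ /=; rewrite Hz.
Qed.

Lemma MFF_transfer : MFF nu.
Proof.
have [supp fact nomem nofin [[Rg [cR sR RgS Rgs mRg]] [Delta [mDelta Delta0 HDelta]]]] := Mmu.
have Delta_nu (s t : R) : 0 < s -> 0 < t -> Delta_of nu s t (fun Z =>
    Delta (s, t, scale (s + t) Z) * split_density g s t Z / g (s + t, Z)).
  by move=> s0 t0; apply: Delta_transfer => //; [exact: HDelta|move=> Z; exact: ltW].
split.
- move=> t t0; apply/family_null => //; last exact: supp.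
  by apply: measurableC; exact: measurable_Csub.
- move=> s t s0 t0.
  have [M ME] := ex_pushforward (prod_probability_fin (nu s) (nu t)) (measurable_oplus s).
  apply/(mequivP ME (erefl _)) => A mA; apply: (density_mequiv (Delta_nu s t s0 t0)) => //.
  by move=> Z; rewrite /split_density !mulr_gt0// invr_gt0.
- move=> t r t0 rt; apply/family_null => //; first exact: measurable_mem.
  exact: nomem.
- move=> t t0 [S HS]; apply: (nofin t t0); exists S; apply/family_null => //.
  rewrite (_ : [set Z | _] = ~` [set Z | Z \in S]); last first.
    by apply/seteqP; split=> Z /= /negP.
  apply: measurableC; elim: S {HS} => [|Z0 S IH].
    by rewrite (_ : [set _ | _] = set0)//; apply/seteqP; split.
  rewrite (_ : [set _ | _] = [set Z0] `|` [set Z | Z \in S]).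
    by apply: measurableU => //; exact: measurable_cset1.
  apply/seteqP; split=> Z /=; rewrite inE; first by move=> /orP[/eqP|]; [left|right].
  by move=> [->|->]; rewrite ?eqxx ?orbT.
- split.
    exists Rg; split => // A RA; have [mA _] := RgS _ RA.
    apply: measurable_posr_fun.
    (* The [nu]-probability in (iv a) becomes a [mu]-integral of a jointly measurable integrand, so
       the ring given for [mu] also serves [nu]. *)
    pose K (z : R * Cl R) : \bar R :=
      (\1_A (scale (posr z.1) z.2) * g (posr z.1, z.2))%:E.
    have mK : measurable_fun setT K.
      apply/measurable_EFinP; apply: measurable_funM.
        apply: measurableT_comp; first exact: measurable_indic.
        apply: measurable_scale => // [z|]; first exact: posr_gt0.
        exact: (measurableT_comp measurable_posr).
      apply: (measurableT_comp mg); apply: measurable_fun_pair => //.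
      exact: (measurableT_comp measurable_posr).
    rewrite (_ : _ \o _ = fun t => (\int[mu (posr t)]_Z K (t, Z))%E).
      apply: (@measurable_integral_MFF R _ R mu id K Mmu _ _ mK) => [//|z].
      by rewrite lee_fin mulr_ge0// ltW.
    apply/funext => t /=; have [_ ->] := dens (posr_gt0 t); last first.
      by rewrite -[X in measurable X]setTI; apply: measurable_scale_fix => //;
        exact: posr_gt0.
    rewrite integral_mkcond; apply: eq_integral => Z _; rewrite patchE /K /= indicE.
    rewrite (_ : (Z \in _) = (scale (posr t) Z \in A)); last first.
      by apply/idP/idP; rewrite !inE.
    by case: ifPn => _; rewrite ?mul1r ?mul0r.
  (* [Delta] receives the set rescaled to [0, 1], while the density factors need the original one.
     [us] undoes the scaling. *)
  pose us (x : R * R * Cl R) := scale (posr (x.1.1 + x.1.2))^-1 x.2.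
  have m1 : measurable_fun setT (fun x : R * R * Cl R => x.1.1).
    exact: (measurableT_comp measurable_fst measurable_fst).
  have m2 : measurable_fun setT (fun x : R * R * Cl R => x.1.2).
    exact: (measurableT_comp measurable_snd measurable_fst).
  have mus : measurable_fun setT us.
    apply: measurable_scale => [x| |//]; first by rewrite invr_gt0 posr_gt0.
    apply: measurable_invr => [x|]; first exact: posr_gt0.
    by apply: (measurableT_comp measurable_posr); exact: measurable_funD.
  exists (fun x => Delta x * split_density g x.1.1 x.1.2 (us x) / g (x.1.1 + x.1.2, us x)); split.
  + apply: measurable_funM.
      by apply: measurable_funM => //; exact: measurable_split_density.
    apply: measurable_invr => //; apply: (measurableT_comp mg).
    by apply: measurable_fun_pair => //; exact: measurable_funD.
  + by move=> x; rewrite /split_density !mulr_gt0// invr_gt0.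
  + move=> s t s0 t0; have st0 : 0 < s + t by rewrite addr_gt0.
    rewrite (_ : (fun Z => _) = (fun Z =>
      Delta (s, t, scale (s + t) Z) * split_density g s t Z / g (s + t, Z))).
      exact: Delta_nu.
    by apply/funext => Z; rewrite /us /= posr_id// scaleK.
Qed.

End equivalent_family.

(** * Multiplication by the square root of the density *)

Lemma density_integral_signed d (T : measurableType d) (R : realType)
    (m1 : {finite_measure set T -> \bar R})
    (m2 : {sigma_finite_measure set T -> \bar R}) (D F : T -> R) :
  is_density m1 m2 D -> (forall x, 0 <= D x) -> measurable_fun setT F ->
  (\int[m1]_x (F x)%:E = \int[m2]_x (F x * D x)%:E)%E.
Proof.
move=> HD D0 mF.
have mE : measurable_fun setT (EFin \o F) by exact/measurable_EFinP.
rewrite integralE [RHS]integralE; congr (_ - _)%E.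
  rewrite (density_integral HD)//; last exact: measurable_funepos.
  apply: eq_integral => x _; rewrite !funeposE /= -!EFin_max -EFinM.
  by rewrite maxr_pMl// mul0r.
rewrite (density_integral HD)//; last exact: measurable_funeneg.
apply: eq_integral => x _; rewrite !funenegE /= -!EFin_max -EFinM.
by rewrite maxr_pMl// mul0r mulNr.
Qed.

Section cplx.
Context {R : realType}.
Implicit Types (r : R) (z w : R[i]).

Lemma Re_realM r z : complex.Re (r%:C * z) = r * complex.Re z.
Proof. by case: z => a b /=; rewrite mul0r subr0. Qed.

Lemma Im_realM r z : complex.Im (r%:C * z) = r * complex.Im z.
Proof. by case: z => a b /=; rewrite mul0r addr0. Qed.

Lemma cnorm2_realM r z : cnorm2 R (r%:C * z) = r ^+ 2 * cnorm2 R z.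
Proof. by rewrite /cnorm2 Re_realM Im_realM; ring. Qed.

Lemma Re_conjM z w : complex.Re (z^* * w) =
  complex.Re z * complex.Re w + complex.Im z * complex.Im w.
Proof. by case: z w => a b [c e] /=; ring. Qed.

Lemma Im_conjM z w : complex.Im (z^* * w) =
  complex.Re z * complex.Im w - complex.Im z * complex.Re w.
Proof. by case: z w => a b [c e] /=; ring. Qed.
End cplx.

Section equivalent_family_isomorphism.
Context {R : realType}.
Variables (mu nu : R -> probability (Cl R) R) (g : R * Cl R -> R).
Hypothesis Mmu : MFF mu.
Hypothesis mg : measurable_fun setT g.
Hypothesis g0 : forall z, 0 < g z.
Hypothesis dens : forall t : R, 0 < t -> is_density (nu t) (mu t) (fun Z => g (t, Z)).

Let rg (z : R * Cl R) := Num.sqrt (g z).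
Let W (t : R) (f : Cl R -> R[i]) : Cl R -> R[i] := fun Z => (rg (t, Z))%:C * f Z.

Let rg_gt0 z : 0 < rg z. Proof. by rewrite sqrtr_gt0. Qed.

Let rgK z : rg z ^+ 2 = g z. Proof. by rewrite sqr_sqrtr// ltW. Qed.

Let mrg : measurable_fun setT rg. Proof. exact: measurable_fun_sqrt. Qed.

Let mrgt (t : R) : measurable_fun setT (fun Z : Cl R => rg (t, Z)).
Proof. exact: (measurableT_comp mrg (pair1_measurable t)). Qed.

Let mgt (t : R) : measurable_fun setT (fun Z : Cl R => g (t, Z)).
Proof. exact: (measurableT_comp mg (pair1_measurable t)). Qed.

Let measurable_cnorm2 (f : Cl R -> R[i]) :
  measurable_fun setT (fun x => complex.Re (f x)) ->
  measurable_fun setT (fun x => complex.Im (f x)) ->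
  measurable_fun setT (fun x => cnorm2 R (f x)).
Proof. by move=> mr mi; apply: measurable_funD; exact: measurable_funX. Qed.

Let measurable_conjM (f h : Cl R -> R[i]) :
  measurable_fun setT (fun x => complex.Re (f x)) ->
  measurable_fun setT (fun x => complex.Im (f x)) ->
  measurable_fun setT (fun x => complex.Re (h x)) ->
  measurable_fun setT (fun x => complex.Im (h x)) ->
  measurable_fun setT (fun x => complex.Re ((f x)^* * h x)) /\
  measurable_fun setT (fun x => complex.Im ((f x)^* * h x)).
Proof.
move=> fr fi hr hi; split.
  under eq_fun do rewrite Re_conjM.
  by apply: measurable_funD; exact: measurable_funM.
under eq_fun do rewrite Im_conjM.
by apply: measurable_funB; exact: measurable_funM.
Qed.

(** The square of [rg] is the density of [nu t], so integrals of products under [nu t] become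
    integrals under [mu t] of products of the images. Surjectivity is division by [rg], which
    vanishes nowhere. *)
Lemma sqrt_density_unitary (t : R) : 0 < t -> Defs.is_unitary (nu t) (mu t) (W t).
Proof.
move=> t0; have g0' Z : 0 <= g (t, Z) by exact: ltW.
have munu : mu t `<< nu t by case: (family_mequiv g0 dens t0).
have int_cnorm2 f : measurable_fun setT (fun x => complex.Re (f x)) ->
    measurable_fun setT (fun x => complex.Im (f x)) ->
    (\int[nu t]_x (cnorm2 R (f x))%:E = \int[mu t]_x (cnorm2 R (W t f x))%:E)%E.
  move=> fr fi; rewrite (density_integral_signed (dens t0))//; last first.
    exact: measurable_cnorm2.
  by apply: eq_integral => x _; rewrite cnorm2_realM rgK mulrC.
have mW f : measurable_fun setT (fun x => complex.Re (f x)) ->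
    measurable_fun setT (fun x => complex.Im (f x)) ->
    measurable_fun setT (fun x => complex.Re (W t f x)) /\
    measurable_fun setT (fun x => complex.Im (W t f x)).
  move=> fr fi; split.
    under eq_fun do rewrite Re_realM.
    exact: measurable_funM.
  under eq_fun do rewrite Im_realM.
  exact: measurable_funM.
split.
- move=> f [fr fi ff]; have [Wr Wi] := mW _ fr fi; split => //.
  by rewrite -int_cnorm2.
- move=> f h _ _ /(ae_dominates munu); apply: filterS => Z /= fh.
  by rewrite /W fh.
- move=> a f h _ _; apply/aeW => Z /=; rewrite /W; ring.
- move=> f h [fr fi _] [hr hi _]; have [cr ci] := measurable_conjM fr fi hr hi.
  rewrite /inner; congr (_ +i* _); congr fine;
    rewrite [RHS](density_integral_signed (dens t0))//; apply: eq_integral => Z _;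
    congr EFin; rewrite ?Re_conjM ?Im_conjM /W !Re_realM !Im_realM -rgK; ring.
- move=> h [hr hi hf].
  pose f Z := ((rg (t, Z))^-1)%:C * h Z.
  have Wf : W t f = h.
    apply/funext => Z; rewrite /W /f mulrA -rmorphM /= divff ?gt_eqF//.
    by rewrite mul1r.
  have mirg : measurable_fun setT (fun Z => (rg (t, Z))^-1) by exact: measurable_invr.
  have fr : measurable_fun setT (fun x => complex.Re (f x)).
    by under eq_fun do rewrite Re_realM; exact: measurable_funM.
  have fi : measurable_fun setT (fun x => complex.Im (f x)).
    by under eq_fun do rewrite Im_realM; exact: measurable_funM.
  exists f; split; first by split => //; rewrite int_cnorm2// Wf.
  by rewrite Wf; apply/aeW.
Qed.

(** Since [rg] is real, a matrix coefficient is the [mu t]-integral of [rg] times one fixed function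
    of the rescaled set, the real or imaginary part of conj(F) G. *)
Lemma sqrt_density_meas_family : meas_family nu mu W.
Proof.
move=> F G Fr Fi Gr Gi _.
have [cr ci] := measurable_conjM Fr Fi Gr Gi.
have H (h : Cl R -> R) : measurable_fun setT h ->
    measurable_fun (`]0, +oo[ : set R) (fun t : R =>
      fine (\int[mu t]_Z (rg (t, Z) * h (scale t Z))%:E)%E).
  move=> mh; apply: measurable_posr_fun.
  pose K (z : R * Cl R) := rg (posr z.1, z.2) * h (scale (posr z.1) z.2).
  have mp : measurable_fun setT (fun z : R * Cl R => posr z.1).
    exact: (measurableT_comp measurable_posr).
  apply: (@measurable_Rintegral_MFF R mu K Mmu); apply: measurable_funM.
    by apply: (measurableT_comp mrg); exact: measurable_fun_pair.
  apply: (measurableT_comp mh); apply: measurable_scale => // z.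
  exact: posr_gt0.
split.
  rewrite (_ : (fun t => _) = fun t : R => fine (\int[mu t]_Z (rg (t, Z) *
     (fun Z => complex.Re ((F Z)^* * G Z)) (scale t Z))%:E)%E); first exact: (H _ cr).
  apply/funext => t /=; congr fine; apply: eq_integral => Z _; congr EFin.
  by rewrite !Re_conjM /W Re_realM Im_realM /=; ring.
rewrite (_ : (fun t => _) = fun t : R => fine (\int[mu t]_Z (rg (t, Z) *
   (fun Z => complex.Im ((F Z)^* * G Z)) (scale t Z))%:E)%E); first exact: (H _ ci).
apply/funext => t /=; congr fine; apply: eq_integral => Z _; congr EFin.
by rewrite !Im_conjM /W Re_realM Im_realM /=; ring.
Qed.

(** [split_density] evaluates g at the same pieces, [restr] and [rshift], as the multiplication
    does. Once both versions of [Delta] are replaced by the explicit ones, intertwining is a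
    pointwise identity: the square root of g_(s+t) cancels and those of g_s and g_t attach to the
    two factors. *)
Lemma rs_isomorphic_transfer : rs_isomorphic nu mu.
Proof.
exists W; split; [exact: sqrt_density_unitary|exact: sqrt_density_meas_family|].
move=> s t s0 t0 Dn Dm HDn HDm f h _ _.
have st0 : 0 < s + t by rewrite addr_gt0.
have munu : mu (s + t) `<< nu (s + t) by case: (family_mequiv g0 dens st0).
have [_ _ _ _ [_ [Delta [mDelta Delta0 HDelta]]]] := Mmu.
have [Mm MmE] := ex_pushforward (prod_probability_fin (mu s) (mu t)) (measurable_oplus s).
have [Mn MnE] := ex_pushforward (prod_probability_fin (nu s) (nu t)) (measurable_oplus s).
pose D Z := Delta (s, t, scale (s + t) Z).
have HDnu : Delta_of nu s t (fun Z => D Z * split_density g s t Z / g (s + t, Z)).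
  apply: (Delta_transfer Mmu mg g0 dens s0 t0); first exact: HDelta.
  by move=> Z; exact: (ltW (Delta0 _)).
have aem : {ae mu (s + t), forall Z, Dm Z = D Z}.
  apply: (density_ae_unique HDm (HDelta s t s0 t0)); rewrite MmE.
    exact: measure_ge0.
  exact: fin_num_fun_lty (fin_num_measure Mm).
have aen : {ae mu (s + t), forall Z, Dn Z = D Z * split_density g s t Z / g (s + t, Z)}.
  apply: (ae_dominates munu); apply: (density_ae_unique HDn HDnu); rewrite MnE.
    exact: measure_ge0.
  exact: fin_num_fun_lty (fin_num_measure Mn).
apply: filterS2 aem aen => Z /= Em En.
rewrite /W /Umul Em En.
have -> : Num.sqrt (D Z * split_density g s t Z / g (s + t, Z)) =
    Num.sqrt (D Z) * rg (s, restr s Z) * rg (t, Defs.rshift s t Z) / rg (s + t, Z).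
  rewrite /rg /split_density !sqrtrM ?mulr_ge0 ?(ltW (g0 _)) ?(ltW (Delta0 _))//.
  by rewrite sqrtrV ?(ltW (g0 _))// mulrA.
have EE : rg (s + t, Z) * (Num.sqrt (D Z) * rg (s, restr s Z) *
    rg (t, Defs.rshift s t Z) / rg (s + t, Z)) =
    Num.sqrt (D Z) * rg (s, restr s Z) * rg (t, Defs.rshift s t Z).
  by rewrite mulrC divfK ?gt_eqF.
rewrite !mulrA -rmorphM /= EE !rmorphM /=; ring.
Qed.

End equivalent_family_isomorphism.

(** * Inverse densities and recovery of a density by differentiation *)

Section density_inverse.
Context d (T : measurableType d) (R : realType).

Lemma density_ae_eq (m1 : set T -> \bar R) (m2 : {measure set T -> \bar R}) (D D' : T -> R) :
  is_density m1 m2 D -> measurable_fun setT D' ->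
  {ae m2, forall x, D x = D' x} -> is_density m1 m2 D'.
Proof.
move=> [mD HD] mD' DD'; split => // A mA; rewrite HD//.
apply: ae_eq_integral => //.
- by apply: measurable_funTS; exact/measurable_EFinP.
- by apply: measurable_funTS; exact/measurable_EFinP.
- by apply: filterS DD' => x -> _.
Qed.

(** The set where [D] is nonpositive has [m1]-mass at most 0, hence is [m1]-null and, by domination,
    [m2]-null. There [D] may be reset to 1. *)
Lemma density_gt0_version (m1 m2 : {finite_measure set T -> \bar R}) (D : T -> R) :
  is_density m1 m2 D -> m2 `<< m1 ->
  exists D', [/\ forall x, 0 < D' x, is_density m1 m2 D' &
                 {ae m2, forall x, D x = D' x}].
Proof.
move=> HD m21; have [mD HDA] := HD.
pose D' x := posr (D x).
have mD' : measurable_fun setT D' by exact: (measurableT_comp measurable_posr).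
have DD' : {ae m2, forall x, D x = D' x}.
  pose A := [set x | D x <= 0].
  have mA : measurable A by exact: measurable_set_le.
  have A0 : m1 A = 0%E.
    apply/eqP; rewrite eq_le measure_ge0 andbT HDA//.
    have ND0 x : A x -> (0 <= (- D x)%:E)%E by move=> Ax; rewrite lee_fin oppr_ge0.
    rewrite (eq_integral (fun x => - (- D x)%:E)%E); last first.
      by move=> x _; rewrite EFinN oppeK.
    by rewrite integral_ge0N// leeNl oppe0 integral_ge0.
  exists A; split => //.
    by move/(null_dominatesP _ (erefl _)) : m21; apply.
  move=> x /= DxD'; rewrite /A /= leNgt; apply/negP => Dx; apply: DxD'.
  by rewrite /D' posr_id.
exists D'; split => //; first by move=> x; exact: posr_gt0.
exact: density_ae_eq DD'.
Qed.

Lemma density_inv (m1 m2 : {finite_measure set T -> \bar R}) (D : T -> R) :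
  (forall x, 0 < D x) -> is_density m1 m2 D ->
  is_density m2 m1 (fun x => (D x)^-1).
Proof.
move=> D0 HD; have [mD HDA] := HD.
have mDi : measurable_fun setT (fun x => (D x)^-1) by exact: measurable_invr.
split => // A mA; rewrite (density_integral HD)//; last 2 first.
- exact/measurable_EFinP.
- by move=> x; rewrite lee_fin invr_ge0 ltW.
transitivity (\int[m2]_(x in A) 1)%E; first by rewrite integral_cst// mul1e.
by apply: eq_integral => x _; rewrite -EFinM mulVf ?gt_eqF.
Qed.
End density_inverse.

Lemma density_differentiation (R : realType)
    (m : set (measurableTypeR R) -> \bar R) (f : R -> R) :
  (m setT < +oo)%E -> (forall x, 0 <= f x) -> is_density m lebesgue_measure f ->
  {ae lebesgue_measure, forall x : R,
    (fun n : nat => ((lebesgue_measure (ball x n.+1%:R^-1))^-1 *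
      m (ball x n.+1%:R^-1))%E) @ \oo --> (f x)%:E}.
Proof.
move=> fm f0 [mf Hm].
have lf : locally_integrable setT f.
  split; [exact: mf|exact: openT|move=> K _ cK].
  have mK : measurable K by apply: closed_measurable; exact: compact_closed.
  apply: le_lt_trans fm; rewrite Hm//.
  have -> : (\int[lebesgue_measure]_(x in K) `|f x|%:E =
      \int[lebesgue_measure]_(x in K) (f x)%:E)%E.
    by apply: eq_integral => x _; rewrite ger0_norm.
  apply: ge0_subset_integral => //.
  - by apply/measurable_EFinP.
  - by move=> x _; rewrite lee_fin.
have [N [mN N0 HN]] := lebesgue_differentiation lf.
exists N; split => // x /= notlim; apply: HN => /= Hx; apply: notlim.
pose E (y : R) (n : nat) : set R := ball y n.+1%:R^-1.
have hE y : nicely_shrinking y (E y).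
  split; first by move=> n; exact: measurable_ball.
  have i0 n : 0 < n.+1%:R^-1 :> R by rewrite invr_gt0.
  (* Each ball is its own comparison ball, with constant 1. *)
  exists (1, fun n => PosNum (i0 n)); split => //=.
  - exact: cvg_harmonic.
  - by move=> n z.
  - by move=> n; rewrite mul1e.
rewrite (_ : (fun n => _) = fun n => ((lebesgue_measure (E x n))^-1 *
    \int[lebesgue_measure]_(y in E x n) (f y)%:E)%E).
  exact: (nice_lebesgue_differentiation hE lf Hx).
by apply/funext => n; rewrite Hm//; exact: measurable_ball.
Qed.

(** * The tilt and its Palm-uniformization *)

Section localized_weight.
Context {R : realType}.

Lemma measurable_eq_cempty d (T : measurableType d) (F : T -> Cl R) :
  measurable_fun setT F -> measurable_fun setT (fun x => F x == cempty R).
Proof.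
move=> mF; apply: (measurable_fun_bool true).
rewrite setTI (_ : _ @^-1` _ = F @^-1` [set cempty R]).
  by rewrite -[X in measurable X]setTI; apply: mF => //; exact: cempty_measurable.
by apply/seteqP; split=> x /= /eqP.
Qed.

Lemma measurable_wloc d (T : measurableType d) (t : T -> R) (F : T -> Cl R) :
  measurable_fun setT t -> measurable_fun setT F ->
  measurable_fun setT (fun x => wloc (t x) (F x)).
Proof.
move=> mt mF.
have ma : measurable_fun setT (fun x => anchor (F x)).
  exact: (measurableT_comp measurable_anchor).
have md : measurable_fun setT (fun x => diam (F x)).
  exact: (measurableT_comp measurable_diam).
(* In the branch with positive anchor, [posr] changes nothing, but it makes the denominator positive
   everywhere, as measurability of the inverse requires. *)
rewrite (_ : (fun x => _) = fun x =>
    if t x < 1 then if F x == cempty R then 1%R else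
    if 0 < anchor (F x) then expR (- (`|ln (anchor (F x))| * diam (F x) *
      (posr (anchor (F x)) ^+ 2)^-1)) else 1%R else 1%R); last first.
  apply/funext => x; rewrite /wloc; case: ifPn => // _; case: ifPn => // _.
  by case: ifPn => // a0; rewrite posr_id.
apply: measurable_fun_ifT => //; first exact: measurable_fun_ltr.
apply: measurable_fun_ifT => //; first exact: measurable_eq_cempty.
apply: measurable_fun_ifT => //; first exact: measurable_fun_ltr.
apply: measurableT_comp; first exact: measurable_expR.
apply: measurableT_comp; first exact: oppr_measurable.
apply: measurable_funM.
  apply: measurable_funM => //; apply: measurableT_comp; first exact: normr_measurable.
  by apply: measurableT_comp; first exact: measurable_ln.
apply: measurable_invr => [x|]; first by rewrite exprn_gt0// posr_gt0.
by apply: measurable_funX; exact: (measurableT_comp measurable_posr).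
Qed.

Lemma wloc_gt0 (t : R) (Z : Cl R) : 0 < wloc t Z.
Proof. by rewrite /wloc; do 3 case: ifP => // _; exact: expR_gt0. Qed.

Lemma wloc_le1 (t s : R) (Z : Cl R) : Csub s Z -> wloc t Z <= 1.
Proof.
move=> Zs; rewrite /wloc; do 2 case: ifP => // _; case: ifPn => // a0.
rewrite -expR0 ler_expR oppr_le0 divr_ge0 ?sqr_ge0// mulr_ge0 ?normr_ge0//.
exact: diam_ge0 Zs.
Qed.

(* The density at [x] of the anchor law of the measure [w P], with respect to
   Lebesgue measure, as a limit of averages over shrinking balls. *)
Definition anchor_density (P : set (Cl R) -> \bar R) (w : Cl R -> R) (x : R) : R :=
  posr (fine (limn_esup (fun n : nat => ((n.+1%:R / 2)%:E *
    \int[P]_Z (if (Z != cempty R) && (`|x - anchor Z| < n.+1%:R^-1)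
               then w Z else 0)%:E)%E))).

(** For each [n] the average is a kernel integral, jointly measurable in the time and the centre.
    The limsup keeps this even at points where the averages do not converge. *)
Lemma measurable_anchor_density (mu : R -> probability (Cl R) R) d
    (T : measurableType d) (t x : T -> R) (w : R * Cl R -> R) :
  MFF mu -> (forall z, 0 <= w z) -> measurable_fun setT w ->
  measurable_fun setT t -> measurable_fun setT x ->
  measurable_fun setT (fun y =>
    anchor_density (mu (posr (t y))) (fun Z => w (posr (t y), Z)) (x y)).
Proof.
move=> Mmu w0 mw mt mx.
apply: (measurableT_comp measurable_posr).
apply: measurableT_comp; first exact: fine_measurable.
apply: measurable_fun_limn_esup => n; apply: emeasurable_funM => //.
pose K (z : T * Cl R) : \bar R := (if (z.2 != cempty R) &&
  (`|x z.1 - anchor z.2| < n.+1%:R^-1) then w (posr (t z.1), z.2) else 0)%:E.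
apply: (@measurable_integral_MFF R _ T mu t K Mmu mt) => [z|].
  by rewrite lee_fin; case: ifP.
apply/measurable_EFinP; apply: measurable_fun_ifT => //.
  apply: measurable_and.
    by apply: measurable_neg; exact: measurable_eq_cempty.
  apply: measurable_fun_ltr => //; apply: measurableT_comp; first exact: normr_measurable.
  apply: measurable_funB; first exact: (measurableT_comp mx).
  exact: (measurableT_comp measurable_anchor).
apply: (measurableT_comp mw); apply: measurable_fun_pair => //.
apply: (measurableT_comp measurable_posr).
exact: (measurableT_comp mt).
Qed.
End localized_weight.

(** * Restricted and tilted measures *)

Lemma ex_mrestr d (T : measurableType d) (R : realType)
    (m : {finite_measure set T -> \bar R}) (A : set T) : measurable A ->
  exists M : {finite_measure set T -> \bar R},
    (fun B => m (B `&` A)) = M :> (set T -> \bar R).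
Proof.
move=> mA; apply: ex_finite_measure.
- by rewrite set0I measure0.
- by move=> B; exact: measure_ge0.
- exact: (@measure_semi_sigma_additive _ _ _ (mrestr m mA)).
- rewrite setTI; by rewrite ltey_eq fin_num_measure.
Qed.

Lemma restr_density d (T : measurableType d) (R : realType)
    (m : {measure set T -> \bar R}) (A : set T) : measurable A ->
  is_density (fun B => m (B `&` A)) m (\1_A).
Proof.
move=> mA; split; first exact: measurable_indic.
by move=> B mB; rewrite integral_indic// setIC.
Qed.

Lemma ge0_integral_restr d (T : measurableType d) (R : realType)
    (m M : {finite_measure set T -> \bar R}) (A : set T) (f : T -> \bar R) :
  measurable A -> (fun B => m (B `&` A)) = M :> (set T -> \bar R) ->
  measurable_fun setT f -> (forall x, 0 <= f x)%E ->
  (\int[M]_x f x = \int[m]_(x in A) f x)%E.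
Proof.
move=> mA ME mf f0; have := restr_density m mA; rewrite ME => dM.
rewrite (density_integral dM)// [RHS]integral_mkcond; apply: eq_integral => x _.
by rewrite patchE indicE; case: ifPn => _; rewrite ?mule1 ?mule0.
Qed.

Lemma ex_tilt (R : realType) (P : {finite_measure set (Cl R) -> \bar R})
    (w : Cl R -> R) :
  (forall Z, 0 < w Z) -> measurable_fun setT w ->
  (0 < \int[P]_Z (w Z)%:E)%E -> (\int[P]_Z (w Z)%:E < +oo)%E ->
  let c := fine (\int[P]_Z (w Z)%:E)%E in
  [/\ 0 < c, is_density (tilt P w) P (fun Z => w Z / c) &
   exists M : {finite_measure set (Cl R) -> \bar R},
     tilt P w = M :> (set (Cl R) -> \bar R)].
Proof.
move=> w0 mw iw0 iwoo c.
have mwE : measurable_fun setT (fun Z => (w Z)%:E) by exact/measurable_EFinP.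
have c0 : 0 < c by rewrite fine_gt0// iw0.
have ci0 : 0 <= c^-1 by rewrite invr_ge0 ltW.
have [M1 M1E] : exists M : {finite_measure set (Cl R) -> \bar R},
    (fun A => \int[P]_(Z in A) (w Z)%:E)%E = M :> (set (Cl R) -> \bar R).
  apply: ex_finite_measure => //.
  - by rewrite integral_set0.
  - by move=> A; apply: integral_ge0 => Z _; rewrite lee_fin ltW.
  - by apply: semi_sigma_additive_nng_induced => // Z; rewrite lee_fin ltW.
split => //.
- split; first by apply: measurable_funM.
  move=> A mA; rewrite /tilt -ge0_integralZl_EFin//; last 2 first.
  + by move=> Z _; rewrite lee_fin ltW.
  + exact: measurable_funTS.
  by apply: eq_integral => Z _; rewrite -EFinM mulrC.
- have M1A A : M1 A = (\int[P]_(Z in A) (w Z)%:E)%E by rewrite -M1E.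
  have tE A : tilt P w A = mscale (NngNum ci0) M1 A 
    by rewrite /tilt /mscale; congr (_ * _)%E; exact: (esym (M1A A)).
  have tEE : tilt P w = mscale (NngNum ci0) M1 by apply/funext.
  apply: ex_finite_measure; rewrite ?tEE.
  + exact: measure0.
  + by move=> A; exact: measure_ge0.
  + exact: measure_semi_sigma_additive.
  + rewrite /mscale /=; apply: lte_mul_pinfty => //.
    by rewrite ltey_eq fin_num_measure.
Qed.

(* Integrals over [R] and over [measurableTypeR R] use distinct (not
   convertible) measurable structures, so the measure is needed at both types. *)
Lemma ex_lebesgue_restr (R : realType) (t : R) : 0 < t ->
  exists (L' : {finite_measure set (measurableTypeR R) -> \bar R})
         (L : {finite_measure set R -> \bar R}),
    [/\ (fun B : set (measurableTypeR R) => lebesgue_measure (B `&` `]0, t])) =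
           L' :> (set (measurableTypeR R) -> \bar R),
         (fun B : set R => lebesgue_measure (B `&` `]0, t])) = L :> (set R -> \bar R) &
         pushforward L' id = L :> (set R -> \bar R)].
Proof.
move=> t0; have mI : measurable (`]0, t]%classic : set (measurableTypeR R)) by [].
pose lam : {measure set (measurableTypeR R) -> \bar R} := mrestr lebesgue_measure mI.
have lam_fin : (lam setT < +oo)%E.
  by rewrite /lam /= /mrestr setTI lebesgue_measure_itv /= lte_fin t0 ltry.
have mid := @measurable_id _ (measurableTypeR R) setT.
have [L' L'E] := @ex_pushforward _ _ (measurableTypeR R) (measurableTypeR R) R
  lam id lam_fin mid.
have [L LE] := @ex_pushforward _ _ (measurableTypeR R) R R lam id lam_fin mid.
exists L', L; split; [by rewrite -L'E|by rewrite -LE|].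
by rewrite -LE -L'E.
Qed.

(** * Identification of the anchor density and of the conditioned uniformization *)

Section palm_uniformization.
Context {R : realType}.
Variables (P : probability (Cl R) R) (t : R) (w : Cl R -> R) (h : R -> R).
Hypothesis t0 : 0 < t.
Hypothesis w0 : forall Z, 0 < w Z.
Hypothesis mw : measurable_fun setT w.
Hypothesis iw : (\int[P]_Z (w Z)%:E < +oo)%E.
Hypothesis Palm : forall B : set R, measurable B ->
  P (@anchor R @^-1` B `&` nonempty_sets R) = 0%E <->
  lebesgue_measure (B `&` `]0, t]) = 0%E.
Hypothesis Hh : is_density (fun B : set R => lebesgue_measure (B `&` `]0, t]))
  (kappa (tilt P w)) h.
Hypothesis mk : measurable_fun setT (anchor_density P w).

Let c := fine (\int[P]_Z (w Z)%:E)%E.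

Let iw_gt0 : (0 < \int[P]_Z (w Z)%:E)%E.
Proof.
rewrite lt_neqAle integral_ge0 ?andbT//; last by move=> Z _; rewrite lee_fin ltW.
apply/negP => /eqP/esym /(pos_integral_eq0 P measurableT mw w0).1.
move=> P0; have : 1%E = 0%E :> \bar R := etrans (esym (probability_setT P)) P0.
by move/eqP; rewrite onee_eq0.
Qed.

Let manchor_pre (B : set R) : measurable B ->
  measurable (@anchor R @^-1` B `&` nonempty_sets R).
Proof.
move=> mB; apply: measurableI; last exact: measurable_nonempty.
by rewrite -[X in measurable X]setTI; exact: measurable_anchor.
Qed.

(** [h] is the derivative of Lebesgue measure on (0, t] by the anchor law, so 1/h is the Lebesgue
    density of the anchor law and differentiation recovers it. [anchor_density] is computed from the
    unnormalized measure w P, which is c times the tilt; hence the factor [c]. The integral is the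
    Lebesgue measure of (0, t]. *)
Lemma anchor_density_ae : exists2 rho : {finite_measure set (Cl R) -> \bar R},
  tilt P w = rho :> (set (Cl R) -> \bar R) &
  [/\ {ae kappa rho, forall x, h x = c / anchor_density P w x},
      (kappa rho setT < +oo)%E &
      (\int[kappa rho]_x (c / anchor_density P w x)%:E = t%:E)%E].
Proof.
have [c0 drho [rho rhoE]] := ex_tilt w0 mw iw_gt0 iw.
exists rho => //; rewrite -/c in c0 drho.
have [rne rneE] := ex_mrestr rho measurable_nonempty.
have rne_fin : (rne setT < +oo)%E by exact: fin_num_fun_lty (fin_num_measure rne).
have [K KE] := ex_pushforward rne_fin measurable_anchor.
have kK : kappa rho = K :> (set R -> \bar R).
  rewrite -KE; apply/funext => B; exact: (congr1 (fun m => m (@anchor R @^-1` B)) rneE).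
have mI : measurable (`]0, t]%classic : set (measurableTypeR R)) by [].
have [LF [L [LFE LB LE]]] := ex_lebesgue_restr t0.
have KB (B : set R) : K B = rho (@anchor R @^-1` B `&` nonempty_sets R) by rewrite -kK.
have KL (B : set R) : measurable B -> K B = 0%E <-> L B = 0%E.
  move=> mB; rewrite KB -LB -(Palm mB) -(congr1 (fun m => m _) rhoE).
  apply: (density_mequiv drho); last exact: manchor_pre.
  by move=> Z; rewrite divr_gt0.
have HhL : is_density L K h by rewrite -LB -kK -rhoE; exact: Hh.
have KdL : K `<< L.
  by apply/(null_dominatesP _ (erefl _)) => B mB /(KL _ mB).
have [H [H0 HL hH]] := density_gt0_version HhL KdL.
have HK := density_inv H0 HL.
have [mHi HKA] := HK.
(* Extending 1/H by zero outside (0, t] gives a density with respect to Lebesgue measure on the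
   whole line, as the differentiation theorem needs. *)
pose f x := (H x)^-1 * \1_(`]0, t]%classic : set R) x.
have f0 x : 0 <= f x by apply: mulr_ge0; [rewrite invr_ge0 ltW|rewrite indicE ler0n].
have mf : measurable_fun setT f.
  by apply: measurable_funM => //; exact: measurable_indic.
have dK : @is_density _ (measurableTypeR R) R K lebesgue_measure f.
  split => // A mA; rewrite HKA//.
  transitivity (\int[LF]_(x in A) ((H x)^-1)%:E)%E.
    rewrite -LE ge0_integral_pushforward//.
    - by apply: measurable_funTS; exact/measurable_EFinP.
    - by move=> x _; rewrite lee_fin invr_ge0 ltW.
  have dLF := restr_density (@lebesgue_measure R) mI; rewrite LFE in dLF.
  rewrite (density_integral dLF)//.
  - exact/measurable_EFinP.
  - by move=> x; rewrite lee_fin invr_ge0 ltW.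
have Kfin : (K setT < +oo)%E by exact: fin_num_fun_lty (fin_num_measure K).
have [N [mN N0 HN]] := density_differentiation Kfin f0 dK.
have adE (x : R) : `]0, t]%classic x -> ~ N x -> anchor_density P w x = c / H x.
  move=> xI Nx.
  have lim : (fun n : nat => ((lebesgue_measure (ball x n.+1%:R^-1))^-1 *
      K (ball x n.+1%:R^-1))%E) @ \oo --> (f x)%:E.
    by apply: contrapT => nlim; apply: Nx; exact: HN.
  have fx : f x = (H x)^-1 by rewrite /f indicE mem_set// mulr1.
  (* The limit is positive and finite, so neither [fine] nor [posr] alters it. *)
  rewrite /anchor_density (_ : limn_esup _ = (c / H x)%:E).
    by rewrite /= posr_id// divr_gt0.
  rewrite (_ : (fun n => _) = fun n : nat => (c%:E *
      ((lebesgue_measure (ball x n.+1%:R^-1))^-1 * K (ball x n.+1%:R^-1)))%E).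
    have climE : (fun n : nat => (c%:E * ((lebesgue_measure (ball x n.+1%:R^-1))^-1 *
        K (ball x n.+1%:R^-1)))%E) @ \oo --> (c / H x)%:E.
      by rewrite EFinM -fx; apply: cvgeZl.
    by rewrite is_cvg_limn_esupE; [apply/cvg_lim|apply/cvg_ex; exists (c / H x)%:E].
  apply/funext => n.
  rewrite lebesgue_measure_ball ?invr_ge0// inver gt_eqF ?pmulrn_lgt0 ?invr_gt0//.
  rewrite KB -(congr1 (fun m => m _) rhoE) /tilt -/c.
  rewrite (_ : \int[P]_(Z in @anchor R @^-1` ball x n.+1%:R^-1 `&` nonempty_sets R) _ =
    \int[P]_Z (if (Z != cempty R) &&
      (`|x - anchor Z| < n.+1%:R^-1)%R then w Z else 0)%:E)%E; last first.
    rewrite integral_mkcond; apply: eq_integral => Z _; rewrite patchE.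
    rewrite (_ : (Z \in _) = (Z != cempty R) && (`|x - anchor Z| < n.+1%:R^-1)%R).
      by case: ifP.
    apply/idP/andP; rewrite inE /= /ball /=.
      by move=> [xZ /eqP Z0]; split.
    by move=> [/eqP Z0 xZ]; split.
  rewrite !muleA -!EFinM; congr (_%:E * _)%E.
  (* A ball of radius 1/(n+1) has Lebesgue measure 2/(n+1), which explains the factor (n+1)/2 in
     [anchor_density]. *)
  have -> : (n.+1%:R^-1 *+ 2)^-1 = n.+1%:R / 2 :> R.
    by rewrite -(mulr_natl (n.+1%:R^-1)) invfM invrK mulrC.
  by rewrite mulrAC divff ?gt_eqF// mul1r.
have hK : {ae K, forall x, h x = c / anchor_density P w x}.
  have aeH : {ae K, forall x, H x = c / anchor_density P w x}.
    exists (N `|` ~` `]0, t]%classic); split.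
    - by apply: measurableU => //; exact: measurableC.
    - apply/KL; first by apply: measurableU => //; exact: measurableC.
      rewrite -LB; apply: (subset_measure0 _ _ _ N0) => //.
        by apply: measurableI => //; apply: measurableU => //; exact: measurableC.
      by move=> x [[|]].
    - move=> x /= Hx; apply: contrapT => /not_orP[Nx /contrapT xI]; apply: Hx.
      by rewrite adE// invf_div mulrC divfK ?gt_eqF.
  by apply: filterS2 hH aeH => x -> ->.
rewrite kK; split => //.
transitivity (\int[K]_x (h x)%:E)%E.
  apply: ae_eq_integral => //.
  - apply/measurable_EFinP; apply: measurable_funM => //.
    by apply: measurable_invr => // x; exact: posr_gt0.
  - case: HhL => mh _; exact/measurable_EFinP.
  - by apply: filterS hK => x -> _.
have [_ <-//] := HhL.
rewrite -LB setTI lebesgue_measure_itv /= lte_fin t0.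
by rewrite oppr0 adde0.
Qed.
(** Both normalizing constants disappear: the density w/c of the tilt cancels the [c] in c /
    anchor_density, and the constant of the uniformization cancels on conditioning. What remains is
    divided by its mass on nonempty sets, which is t. *)
Lemma cond_ne_unif (A : set (Cl R)) : measurable A ->
  cond_ne (unif (tilt P w) h) A =
    ((t^-1)%:E * \int[P]_(Z in A `&` nonempty_sets R)
      (w Z / anchor_density P w (anchor Z))%:E)%E /\
  (\int[P]_(Z in nonempty_sets R) (w Z / anchor_density P w (anchor Z))%:E = t%:E)%E.
Proof.
move=> mA; have mne := measurable_nonempty (R := R).
have [c0 drho _] := ex_tilt w0 mw iw_gt0 iw; rewrite -/c in c0 drho.
have [rho rhoE [hk _ kint]] := anchor_density_ae.
rewrite rhoE in drho *.
have k0 x : 0 < anchor_density P w x by exact: posr_gt0.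
pose u Z := if Z == cempty R then 1%R else h (anchor Z).
(* This explicit weight replaces the one built from [h]. They differ only on a null set of the tilt,
   so all integrals agree. *)
pose u' Z := if Z == cempty R then 1%R else c / anchor_density P w (anchor Z).
have mck : measurable_fun setT (fun x => c / anchor_density P w x).
  by apply: measurable_funM => //; exact: measurable_invr.
have mcka : measurable_fun setT (fun Z => c / anchor_density P w (anchor Z)).
  exact: (measurableT_comp mck measurable_anchor).
have mu' : measurable_fun setT u'.
  by apply: measurable_fun_ifT => //; exact: measurable_eq_cempty.
have mu_ : measurable_fun setT u.
  case: Hh => mh _; apply: measurable_fun_ifT => //; first exact: measurable_eq_cempty.
  exact: (measurableT_comp mh measurable_anchor).
have ck0 x : 0 < c / anchor_density P w x by rewrite divr_gt0.
have u'0 Z : 0 < u' Z by rewrite /u'; case: ifP.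
have uu' : {ae rho, forall Z, u Z = u' Z}.
  have [N [mN N0 HN]] := hk.
  exists (@anchor R @^-1` N `&` nonempty_sets R); split => //; first exact: manchor_pre.
  move=> Z /=; rewrite /u /u'; case: eqP => // Z0 hN.
  by split => //; exact: HN.
have SE B : measurable B -> (\int[rho]_(Z in B) (u Z)%:E = \int[rho]_(Z in B) (u' Z)%:E)%E.
  move=> mB; apply: ae_eq_integral => //.
  - by apply: measurable_funTS; exact/measurable_EFinP.
  - by apply: measurable_funTS; exact/measurable_EFinP.
  - by apply: filterS uu' => Z -> _.
have u'ne B : B `<=` nonempty_sets R -> (\int[rho]_(Z in B) (u' Z)%:E =
    \int[rho]_(Z in B) (c / anchor_density P w (anchor Z))%:E)%E.
  move=> Bne; apply: eq_integral => Z; rewrite inE => /Bne Z0.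
  by rewrite /u'; case: eqP.
have Sne : (\int[rho]_(Z in nonempty_sets R) (u' Z)%:E = t%:E)%E.
  rewrite u'ne// -kint.
  have [rne rneE] := ex_mrestr rho measurable_nonempty.
  rewrite -(ge0_integral_restr mne rneE); last 2 first.
  - exact/measurable_EFinP.
  - by move=> Z; rewrite lee_fin ltW.
  rewrite (_ : kappa rho = pushforward rne (@anchor R)).
    rewrite ge0_integral_pushforward//.
    - exact: measurable_anchor.
    - exact/measurable_EFinP.
    - by move=> x _; rewrite lee_fin ltW.
  by apply/funext => B; exact: (congr1 (fun m => m (@anchor R @^-1` B)) rneE).
(* The total mass is thus positive and finite, so [fine] in the normalization of [unif] returns its
   true value and the division is legitimate. *)
have ST : (\int[rho]_Z (u' Z)%:E = rho [set cempty R] + t%:E)%E.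
  rewrite -(setUv [set cempty R]) ge0_integral_setU//; last 4 first.
  - exact: cempty_measurable.
  - by apply: measurable_funTS; exact/measurable_EFinP.
  - by move=> Z _; rewrite lee_fin ltW.
  - by apply/disj_setPCl.
  rewrite Sne; congr (_ + _)%E.
  rewrite (eq_integral (cst 1%E)); last first.
    by move=> Z; rewrite inE => ->; rewrite /u' eqxx.
  by rewrite integral_cst ?mul1e//; exact: cempty_measurable.
pose N := fine (\int[rho]_Z (u Z)%:E)%E.
have N0 : 0 < N.
  rewrite /N SE// ST; apply: fine_gt0.
  rewrite lte_add_pinfty ?ltry// ?andbT; last first.
    by rewrite ltey_eq fin_num_measure//; exact: cempty_measurable.
  by apply: lt_le_trans (leeDr _ (measure_ge0 _ _)); rewrite lte_fin.
have unifE B : measurable B ->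
    unif rho h B = (N^-1%:E * \int[rho]_(Z in B) (u' Z)%:E)%E.
  by move=> mB; rewrite -SE.
have mAne : measurable (A `&` nonempty_sets R) by exact: measurableI.
have rhoP B : measurable B ->
    (\int[rho]_(Z in B) (c / anchor_density P w (anchor Z))%:E =
     \int[P]_(Z in B) (w Z / anchor_density P w (anchor Z))%:E)%E.
  move=> mB; rewrite (density_integral drho)//; last 2 first.
  - exact/measurable_EFinP.
  - by move=> Z; rewrite lee_fin ltW.
  apply: eq_integral => Z _; rewrite -EFinM; congr EFin.
  by field; rewrite !gt_eqF.
split; last by rewrite -rhoP// -u'ne.
rewrite /cond_ne !unifE// Sne u'ne; last exact: subIsetr.
rewrite rhoP//.
rewrite muleAC -EFinM /=; congr (_%:E * _)%E.
by rewrite invfM invrK mulrA mulVf ?mul1r// gt_eqF.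
Qed.

End palm_uniformization.

Lemma ex_probability d (T : measurableType d) (R : realType)
    (m : {measure set T -> \bar R}) (D : T -> R) :
  measurable_fun setT D -> (forall x, 0 < D x) -> (\int[m]_x (D x)%:E = 1)%E ->
  exists P : probability T R, is_density P m D.
Proof.
move=> mD D0 D1.
have [M ME] : exists M : {finite_measure set T -> \bar R},
    (fun A => \int[m]_(x in A) (D x)%:E)%E = M :> (set T -> \bar R).
  apply: ex_finite_measure.
  - by rewrite integral_set0.
  - by move=> A; apply: integral_ge0 => x _; rewrite lee_fin ltW.
  - apply: semi_sigma_additive_nng_induced; first exact/measurable_EFinP.
    by move=> x; rewrite lee_fin ltW.
  - by rewrite D1 ltry.
have M1 : M setT = 1%E by rewrite -ME.
pose i := Measure_isProbability.Build d T R M M1.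
pose P : probability T R := HB.pack (M : set T -> \bar R) M i.
exists P; split => // A mA.
by rewrite (_ : P A = M A)// -ME.
Qed.

Lemma palm_uniformizableP (R : realType) (mu : R -> probability (Cl R) R) :
  palm_uniformizable mu -> forall t, 0 < t -> forall B : set R, measurable B ->
  mu t (@anchor R @^-1` B `&` nonempty_sets R) = 0%E <->
  lebesgue_measure (B `&` `]0, t]) = 0%E.
Proof.
move=> Hp t t0; have [_ [L [_ LE _]]] := ex_lebesgue_restr t0.
have [mne mneE] := ex_mrestr (mu t) (measurable_nonempty (R := R)).
have mne_fin : (mne setT < +oo)%E by exact: fin_num_fun_lty (fin_num_measure mne).
have [K KE] := ex_pushforward mne_fin measurable_anchor.
have muK : pushforward (fun A => mu t (A `&` nonempty_sets R)) (@anchor R) = K :> (set R -> _).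
  by rewrite -KE; apply/funext => B; exact: (congr1 (fun m => m (@anchor R @^-1` B)) mneE).
exact: (mequivP muK LE).1 (Hp t t0).
Qed.

(** * The explicit density of nu_t *)

Section nu_density.
Context {R : realType}.
Variables (mu : R -> probability (Cl R) R) (beta : R) (h : R -> R -> R).
Hypothesis Mmu : MFF mu.
Hypothesis Palm : palm_uniformizable mu.
Hypothesis mu0 : forall t, 0 < t -> (0 < mu t [set cempty R])%E.
Hypothesis beta0 : 0 < beta.
Hypothesis Hh : forall t, 0 < t ->
  is_density (fun B : set R => lebesgue_measure (B `&` `]0, t]))
             (kappa (mu_loc mu t) : set R -> \bar R) (h t).

(** The first branch spreads the prescribed atom exp(-beta t) over the atom of [mu t]. In the
    second, the factor 1/t normalizes the uniformized nonempty part. [h] is absent, so joint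
    measurability does not depend on the chosen versions. *)
Definition nu_density (z : R * Cl R) : R :=
  let t := posr z.1 in
  if z.2 == cempty R then expR (- (beta * t)) / fine (mu t [set cempty R])
  else (1 - expR (- (beta * t))) / t *
       (wloc t z.2 / anchor_density (mu t) (wloc t) (anchor z.2)).

Let mu0_fine (t : R) : 0 < fine (mu (posr t) [set cempty R]).
Proof.
apply: fine_gt0; rewrite mu0 ?posr_gt0//=.
by rewrite ltey_eq fin_num_measure//; exact: cempty_measurable.
Qed.

Let expbeta_lt1 (t : R) : 0 < t -> expR (- (beta * t)) < 1.
Proof. by move=> t0; rewrite expR_lt1 oppr_lt0 mulr_gt0. Qed.

Lemma nu_density_gt0 z : 0 < nu_density z.
Proof.
have t0 := posr_gt0 z.1.
rewrite /nu_density; case: ifP => _; first by rewrite divr_gt0 ?expR_gt0.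
apply: mulr_gt0; apply: divr_gt0 => //.
- by rewrite subr_gt0 expbeta_lt1.
- exact: wloc_gt0.
- exact: posr_gt0.
Qed.

Let mposr1 : measurable_fun setT (fun z : R * Cl R => posr z.1).
Proof. exact: (measurableT_comp measurable_posr). Qed.

Lemma measurable_nu_density : measurable_fun setT nu_density.
Proof.
have mexp : measurable_fun setT (fun z : R * Cl R => expR (- (beta * posr z.1))).
  apply: measurableT_comp; first exact: measurable_expR.
  by apply: measurableT_comp; [exact: oppr_measurable|exact: measurable_funM].
apply: measurable_fun_ifT; first exact: measurable_eq_cempty.
  apply: measurable_funM => //; apply: measurable_invr; first by move=> z.
  apply: measurableT_comp; first exact: fine_measurable.
  pose K (z : R * Cl R * Cl R) : \bar R := (\1_[set cempty R] z.2)%:E.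
  have mK : measurable_fun setT K.
    apply/measurable_EFinP; apply: measurableT_comp => //.
    by apply: measurable_indic; exact: cempty_measurable.
  rewrite (_ : (fun z => _) = fun z : R * Cl R => (\int[mu (posr z.1)]_Z K (z, Z))%E).
    by apply: (measurable_integral_MFF Mmu) => // z; rewrite lee_fin.
  apply/funext => z; rewrite integral_indic ?setIT//; exact: cempty_measurable.
apply: measurable_funM; apply: measurable_funM.
- exact: measurable_funB.
- by apply: measurable_invr => // z; exact: posr_gt0.
- exact: measurable_wloc.
- apply: measurable_invr => [z|]; first exact: posr_gt0.
  apply: (measurable_anchor_density (w := fun z => wloc z.1 z.2) Mmu) => //.
  + by move=> z; rewrite ltW// wloc_gt0.
  + exact: measurable_wloc.
  + exact: (measurableT_comp measurable_anchor).
Qed.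

Let wloc_int_fin (t : R) : 0 < t -> (\int[mu t]_Z (wloc t Z)%:E < +oo)%E.
Proof.
move=> t0; have mw : measurable_fun setT (wloc t).
  exact: (@measurable_wloc _ _ (Cl R) (cst t) id).
(* The bound [wloc t Z <= 1] is available only for bounded sets. Truncating at 1 makes it hold
   everywhere and changes [wloc] only on a null set. *)
have mw1 : measurable_fun setT (fun Z => Num.min (wloc t Z) 1).
  exact: measurable_minr.
apply: (@le_lt_trans _ _ (\int[mu t]_Z (Num.min (wloc t Z) 1)%:E)%E).
  rewrite (ae_eq_integral (fun Z => (Num.min (wloc t Z) 1)%:E))//.
  - exact/measurable_EFinP.
  - exact/measurable_EFinP.
  - have [supp _ _ _ _] := Mmu.
    exists (~` Csub t); split; [|exact: supp|].
      by apply: measurableC; exact: measurable_Csub.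
    move=> Z /= HZ Zt; apply: HZ => _.
    by rewrite (min_idPl (wloc_le1 _ Zt)).
apply: (@le_lt_trans _ _ (\int[mu t]_Z 1)%E).
  apply: ge0_le_integral => //.
  - by move=> Z _; rewrite lee_fin le_min ler01 ltW// wloc_gt0.
  - exact/measurable_EFinP.
  - by move=> Z _; rewrite lee_fin ge_min lexx orbT.
by rewrite integral_cst// mul1e (le_lt_trans (probability_le1 _ _)) ?ltry.
Qed.

Lemma nu_densityE (t : R) : 0 < t ->
  (forall A, measurable A ->
    (\int[mu t]_(Z in A) (nu_density (t, Z))%:E = nu_def mu beta h t A)%E) /\
  (\int[mu t]_Z (nu_density (t, Z))%:E = 1)%E.
Proof.
move=> t0; have pt := posr_id t0.
have mw : measurable_fun setT (wloc t).
  exact: (@measurable_wloc _ _ (Cl R) (cst t) id).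
have mk : measurable_fun setT (anchor_density (mu t) (wloc t)).
  have := @measurable_anchor_density R mu _ R (cst t) id (fun z => wloc z.1 z.2) Mmu.
  rewrite /= pt; apply => //; first by move=> z; rewrite ltW// wloc_gt0.
  exact: measurable_wloc.
have key A (mA : measurable A) := cond_ne_unif t0 (wloc_gt0 t) mw (wloc_int_fin t0)
  (palm_uniformizableP Palm t0) (Hh t0) mk mA.
pose k Z := wloc t Z / anchor_density (mu t) (wloc t) (anchor Z).
have k0 Z : 0 < k Z by rewrite divr_gt0 ?wloc_gt0 ?posr_gt0.
have mkk : measurable_fun setT k.
  apply: measurable_funM => //; apply: measurable_invr => [Z|]; first exact: posr_gt0.
  exact: (measurableT_comp mk measurable_anchor).
have mg : measurable_fun setT (fun Z => (nu_density (t, Z))%:E).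
  apply/measurable_EFinP.
  exact: (measurableT_comp measurable_nu_density (pair1_measurable t)).
have mE := cempty_measurable (R := R); have mne := measurable_nonempty (R := R).
have e1 := expbeta_lt1 t0.
have split_int A : measurable A -> (\int[mu t]_(Z in A) (nu_density (t, Z))%:E =
    (expR (- (beta * t)))%:E * (\1_A (cempty R))%:E +
    (1 - expR (- (beta * t)))%R%:E *
     ((t^-1)%:E * \int[mu t]_(Z in A `&` nonempty_sets R) (k Z)%:E))%E.
  move=> mA; rewrite -{1}(setIT A) -(setUv [set cempty R]) setIUr.
  rewrite ge0_integral_setU//; last 5 first.
  - exact: measurableI.
  - exact: measurableI.
  - exact: measurable_funTS.
  - by move=> Z _; rewrite lee_fin ltW// nu_density_gt0.
  - by rewrite disj_set2E setIACA setICr setI0.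
  congr (_ + _)%E.
    rewrite (eq_integral (cst (nu_density (t, cempty R))%:E)); last first.
      by move=> Z; rewrite inE => -[_ ->].
    rewrite integral_cst; last exact: measurableI.
    rewrite /nu_density /= eqxx pt indicE.
    have [A0|A0] := boolP (cempty R \in A).
      rewrite (_ : A `&` _ = [set cempty R]); last first.
        by apply/setIidr => Z ->; exact: set_mem.
      rewrite mule1 -[X in (_ * X)%E]fineK ?fin_num_measure// -EFinM divfK//.
      by rewrite gt_eqF// -{1}pt.
    rewrite (_ : A `&` _ = set0) ?measure0 ?mule0//.
    by apply/seteqP; split => // Z [AZ Z0]; move: A0; rewrite -Z0 mem_set.
  rewrite muleA -EFinM -ge0_integralZl_EFin//; last 4 first.
  - exact: measurableI.
  - by move=> Z _; rewrite lee_fin ltW.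
  - by apply: measurable_funTS; exact/measurable_EFinP.
  - by apply: divr_ge0; [rewrite subr_ge0 ltW|exact: ltW].
  apply: eq_integral => Z; rewrite inE => -[_ /eqP Z0].
  by rewrite /nu_density /= (negbTE Z0) pt EFinM.
split=> [A mA|]; first by rewrite split_int// /nu_def (key _ mA).1.
(* The two branches carry masses exp(-beta t) and 1 - exp(-beta t), the latter because the integral
   t on nonempty sets cancels 1/t. *)
rewrite split_int// setTI (key _ measurableT).2 -[X in (_ + _ * X)%E]EFinM mulVf ?gt_eqF// mule1.
by rewrite indicE mem_set// mule1 -EFinD addrC subrK.
Qed.
End nu_density.

(** * The vacuum unit and the final assembly *)

Lemma one_sub_expRN_ge_half (R : realType) (x : R) : 0 < x -> x <= 1 ->
  x / 2 <= 1 - expR (- x).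
Proof.
move=> x0 x1; have ex : 1 + x <= expR x by exact: expR_ge1Dx.
have h1 : expR (- x) <= (1 + x)^-1.
  by rewrite expRN lef_pV2 ?posrE ?expR_gt0// addr_gt0.
(* After clearing denominators this says that x (1 - x) is nonnegative, which is where x <= 1
   enters. *)
have h2 : (1 + x)^-1 <= 1 - x / 2.
  have x10 : 0 < 1 + x by rewrite addr_gt0.
  by rewrite -div1r ler_pdivrMr//; nra.
by move: h1 h2; set y := expR (- x); set z := (1 + x)^-1; lra.
Qed.

Lemma inner_vacuum (R : realType) (P : probability (Cl R) R) :
  (0 < P [set cempty R])%E ->
  inner P (fun _ => 1) (vacuum P) = (Num.sqrt (fine (P [set cempty R])))%:C.
Proof.
move=> P0; have mE := cempty_measurable (R := R).
have Pf : P [set cempty R] \is a fin_num by rewrite fin_num_measure.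
pose s := Num.sqrt (fine (P [set cempty R])).
have s0 : 0 < s by rewrite sqrtr_gt0 fine_gt0// P0 ltey_eq Pf.
rewrite /inner; congr (_ +i* _).
  transitivity (fine (\int[P]_Z ((s^-1)%:E * (\1_[set cempty R] Z)%:E)%E)).
    by congr fine; apply: eq_integral => Z _; rewrite /vacuum Re_conjM /= mul1r mul0r addr0.
  rewrite ge0_integralZl_EFin//; last 2 first.
  - by apply/measurable_EFinP; exact: measurable_indic.
  - by rewrite invr_ge0 ltW.
  rewrite integral_indic// setIT -[X in (_ * X)%E]fineK// -EFinM /=.
  have ss : fine (P [set cempty R]) = s * s.
    by rewrite -expr2 sqr_sqrtr ?fine_ge0.
  by rewrite -/s ss mulrA mulVf ?mul1r ?gt_eqF.
rewrite (eq_integral (cst 0%E)) ?integral0// => Z _.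
by rewrite /vacuum Im_conjM /= mulr0 mul0r subr0.
Qed.

Theorem theorem4p21 (R : realType) (mu : R -> probability (Cl R) R)
  (beta : R) (h : R -> R -> R) :
  MFF mu -> palm_uniformizable mu ->
  (forall t, 0 < t -> (0 < mu t [set cempty R])%E) ->
  0 < beta ->
  (* h t is a Borel version of d Leb|_(0,t] / d kappa_t, kappa_t built from
     rho = mu_t^{loc,alpha} *)
  (forall t, 0 < t ->
     is_density (fun B : set R => lebesgue_measure (B `&` `]0, t]))
                (kappa (mu_loc mu t)) (h t)) ->
  exists nu : R -> probability (Cl R) R,
    [/\ (forall t, 0 < t -> forall A, measurable A -> nu t A = nu_def mu beta h t A),
        (* (i) *)
        MFF nu /\ (forall t, 0 < t -> mequiv (nu t) (mu t)),
        (* (ii) *)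
        rs_isomorphic nu mu
      & (* (iii) *)
        (forall t, 0 < t ->
           inner (nu t) (fun _ => 1) (vacuum (nu t)) = (expR (- (beta * t) / 2))%:C) /\
        (forall t, 0 < t -> t <= 2 / beta ->
           beta / 4 * t <= 1 - expR (- (beta * t) / 2))].
Proof.
move=> Mmu Palm mu0 beta0 Hh.
pose g := nu_density mu beta.
have mg : measurable_fun setT g by exact: measurable_nu_density.
have g0 z : 0 < g z by exact: nu_density_gt0.
have mgt t : measurable_fun setT (fun Z : Cl R => g (t, Z)).
  exact: (measurableT_comp mg (pair1_measurable t)).
have [nu Hnu] : exists nu : R -> probability (Cl R) R,
    forall t, 0 < t -> is_density (nu t) (mu t) (fun Z => g (t, Z)).
  have ex t : exists P : probability (Cl R) R,
      0 < t -> is_density P (mu t) (fun Z => g (t, Z)).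
    (* Nothing is required at nonpositive times, so any probability can fill the family there. *)
    have [t0|t0] := boolP (0 < t); last by exists (mu t).
    have [|P HP] := ex_probability (m := mu t) (mgt t) (fun Z => g0 (t, Z)).
      by have [] := nu_densityE Mmu Palm mu0 beta0 Hh t0.
    by exists P.
  by have [nu Hnu] := choice ex; exists nu.
have nuE t (t0 : 0 < t) A : measurable A -> nu t A = nu_def mu beta h t A.
  move=> mA; have [_ ->//] := Hnu t t0.
  by have [H _] := nu_densityE Mmu Palm mu0 beta0 Hh t0; exact: H.
exists nu; split => //.
- split; first exact: MFF_transfer Mmu mg g0 Hnu.
  by move=> t; exact: (family_mequiv g0 Hnu).
- exact: rs_isomorphic_transfer Mmu mg g0 Hnu.
- split=> [t t0|t t0 tb].
    have nu0 : nu t [set cempty R] = (expR (- (beta * t)))%:E.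
      have mE := cempty_measurable (R := R).
      have fm : mu t [set cempty R] \is a fin_num by rewrite fin_num_measure.
      have [_ ->//] := Hnu t t0.
      rewrite (eq_integral (cst (g (t, cempty R))%:E)); last first.
        by move=> Z; rewrite inE => ->.
      rewrite integral_cst// -[X in (_ * X)%E]fineK// -EFinM /g /nu_density /=.
      rewrite eqxx posr_id// divfK// gt_eqF// fine_gt0// mu0//=.
      by rewrite ltey_eq fm.
    rewrite inner_vacuum nu0 ?lte_fin ?expR_gt0//=.
    have -> : expR (- (beta * t)) = expR (- (beta * t) / 2) ^+ 2.
      by rewrite expr2 -expRD -splitr.
    by rewrite sqrtr_sqr ger0_norm ?expR_ge0.
  (* With x = beta t / 2 the range t <= 2 / beta is exactly x <= 1, and the bound x / 2 is beta t /
     4. *)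
  have x1 : beta * t / 2 <= 1.
    rewrite ler_pdivrMr// mul1r mulrC -ler_pdivlMr//.
  have x0 : 0 < beta * t / 2 by rewrite divr_gt0 ?mulr_gt0.
  have := one_sub_expRN_ge_half x0 x1.
  by rewrite mulNr; set y := expR _; lra.
Qed.
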